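(* Let $\sigma$ be a critical permutation of size $n\ge9$. Then the cover graph $\Gamma_\sigma$ is a dumbbell: it consists of the two four-cycles $\mathcal C_-$ and $\mathcal C_+$, which are vertex-disjoint, joined by a path through the remaining $n-8$ points. Here $\mathcal C_-$ (resp. $\mathcal C_+$) is the four-cycle of $\Gamma_\sigma$ with vertex set the (unique) SW corner core $C_-$ (resp. the unique NE corner core $C_+$) of $\sigma$, whose edges are the four minimal inversions of the pattern of $C_-$ (resp. $C_+$).
   Context: **Cover graph.** For $\sigma=\sigma_1\cdots\sigma_n\in S_n$ an inversion is a pair of positions $i<k$ with $\sigma_i>\sigma_k$; it is minimal if there is no $j$ with $i<j<k$ and $\sigma_i>\sigma_j>\sigma_k$. $\mathrm{Cov}(\sigma)$ is the set of minimal inversions and the cover graph $\Gamma_\sigma$ is the undirected graph on the points (positions) of $\sigma$ with edge set $\mathrm{Cov}(\sigma)$. A dumbbell is a graph consisting of two vertex-disjoint cycles joined by a path. **Corners.** The four corners of $\sigma$ are the positions W $=1$, N $=\sigma^{-1}(n)$, S $=\sigma^{-1}(1)$, E $=n$. The window of the W or N corner at position $d$ is $\{k>d:\sigma_k<\sigma_d\}$; the window of the S or E corner at position $d$ is $\{k<d:\sigma_k>\sigma_d\}$. A corner is good if $\sigma$ restricted to its window is decreasing. An ascent pair is a pair of positions $i<j$ with $\sigma_i<\sigma_j$. An SW corner core of $\sigma$ is a four-point set containing the W and S corners, whose pattern is $3412$ or $4231$, and such that the window of the W corner and the window of the S corner each contain an ascent pair of points of the set. An NE corner core is a four-point set containing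 the N and E corners, with pattern $3412$ or $4231$, such that the windows of the N corner and of the E corner each contain an ascent pair of points of the set. (The minimal inversions of $3412$ are $(1,3),(1,4),(2,3),(2,4)$; those of $4231$ are $(1,2),(1,3),(2,4),(3,4)$.) **Pseudosmooth and critical permutations.** The direct sum $\alpha\oplus\beta$ of $\alpha\in S_a,\beta\in S_b$ is $(\alpha\oplus\beta)_i=\alpha_i$ for $i\le a$, $=\beta_{i-a}+a$ for $i>a$. A permutation is decomposable if it is a direct sum of two nonempty permutations, indecomposable otherwise; every permutation is uniquely a direct sum of (nonempty) indecomposable summands. For a position $d$, $\sigma-d$ is the permutation of size $n-1$ order-isomorphic to $\sigma$ with the entry at position $d$ removed. For $q\in S_k$ and positive integers $\ell=(\ell_1,\dots,\ell_k)$, the inflation $q[\ell]$ replaces the $i$-th entry of $q$ by a block of $\ell_i$ consecutive values in decreasing order, blocks placed left to right with value intervals ordered according to $q$. A tower is an inflation of one of $3412$, $4231$, $35142$, $42513$, $45312$, $426153$, $463152$, $526413$. Recursively: the empty permutation and $1\in S_1$ are pseudosmooth; an indecomposable $\sigma$ with $|\sigma|>1$ is pseudosmooth if it is a tower or has a good corner $\mathbf c$ with $\sigma-\mathbf c$ pseudosmooth; a general permutation is pseudosmooth if all its indecomposable summands are. A permutation is critical if it is not pseudosmooth but every proper pattern of it is. *)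

(* Defs.v *)
From mathcomp Require Import all_boot all_fingroup.

Set Implicit Arguments.
Unset Strict Implicit.
Unset Printing Implicit Defensive.

(* Permutations are elements of 'S_n acting on 'I_n = {0, .., n-1}: positions *)
(* and values are 0-based.  One-line words are 1-based, so that concrete      *)
(* patterns read as usual.                                                    *)

Definition oneline n (s : 'S_n) : seq nat := [seq (s i).+1 | i <- enum 'I_n].

(* 1-based standardization of a word without repeated letters *)
Definition std (w : seq nat) : seq nat := [seq count (leq^~ x) w | x <- w].

(* [enum C] lists C by increasing position. *)
Definition pattern_on n (s : 'S_n) (C : {set 'I_n}) : seq nat :=
  std [seq val (s i) | i <- enum C].

Definition contains n (s : 'S_n) k (t : 'S_k) : Prop :=
  exists C : {set 'I_n}, pattern_on s C = oneline t.

Definition is_deletion n (s : 'S_n) (d : 'I_n) m (t : 'S_m) : Prop :=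
  oneline t = pattern_on s [set~ d].

Definition inversion n (s : 'S_n) (i k : 'I_n) : bool := (i < k) && (s k < s i).

(* Minimal inversions of the pattern of s on C, read at the points of C *)
Definition min_inversion_on n (s : 'S_n) (C : {set 'I_n}) (i k : 'I_n) : bool :=
  [&& i \in C, k \in C, inversion s i k &
      ~~ [exists j : 'I_n in C, [&& i < j, j < k, s k < s j & s j < s i]]].

Definition Cov n (s : 'S_n) (i k : 'I_n) : bool :=
  inversion s i k && ~~ [exists j : 'I_n, [&& i < j, j < k, s k < s j & s j < s i]].

Definition cover_graph n (s : 'S_n) : rel 'I_n :=
  fun x y => Cov s x y || Cov s y x.

Inductive corner := W_corner | N_corner | S_corner | E_corner.

Definition corner_at n (s : 'S_n) (c : corner) (d : 'I_n) : bool :=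
  match c with
  | W_corner => d == 0 :> nat
  | N_corner => (s d).+1 == n
  | S_corner => s d == 0 :> nat
  | E_corner => d.+1 == n
  end.

Definition window n (s : 'S_n) (c : corner) (d : 'I_n) : {set 'I_n} :=
  match c with
  | W_corner | N_corner => [set k : 'I_n | (d < k) && (s k < s d)]
  | S_corner | E_corner => [set k : 'I_n | (k < d) && (s d < s k)]
  end.

Definition good_corner n (s : 'S_n) (c : corner) (d : 'I_n) : Prop :=
  corner_at s c d /\
  {in window s c d &, forall i j : 'I_n, i < j -> s j < s i}.

Definition ascent_pair n (s : 'S_n) (i j : 'I_n) : bool := (i < j) && (s i < s j).

Definition corner_core n (s : 'S_n) (c1 c2 : corner) (C : {set 'I_n}) : Prop :=
  [/\ #|C| = 4,
      pattern_on s C \in [:: [:: 3; 4; 1; 2]; [:: 4; 2; 3; 1]] &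
      forall c, c = c1 \/ c = c2 ->
        exists2 d : 'I_n, corner_at s c d && (d \in C) &
          exists i j : 'I_n, [/\ i \in C :&: window s c d,
                                 j \in C :&: window s c d & ascent_pair s i j]].

Definition SW_core n (s : 'S_n) : {set 'I_n} -> Prop :=
  corner_core s W_corner S_corner.
Definition NE_core n (s : 'S_n) : {set 'I_n} -> Prop :=
  corner_core s N_corner E_corner.

Definition dsum (u v : seq nat) : seq nat := u ++ [seq size u + x | x <- v].

Definition decomposable n (s : 'S_n) : Prop :=
  exists a b (t : 'S_a) (u : 'S_b),
    [/\ 0 < a, 0 < b & oneline s = dsum (oneline t) (oneline u)].

(* The summands of the decomposition of s into nonempty indecomposables are,  *)
(* by its uniqueness, the nonempty indecomposable t with s = u (+) t (+) v    *)
(* for some possibly empty u and v.                                           *)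
Definition indecomposable_summand n (s : 'S_n) m (t : 'S_m) : Prop :=
  [/\ 0 < m, ~ decomposable t &
      exists a b (u : 'S_a) (v : 'S_b),
        oneline s = dsum (oneline u) (dsum (oneline t) (oneline v))].

Definition inflation (q l : seq nat) : seq nat :=
  flatten
    [seq rev (iota (\sum_(j < size q | nth 0 q j < nth 0 q i) nth 0 l j).+1
                   (nth 0 l i)) | i <- iota 0 (size q)].

Definition tower_bases : seq (seq nat) :=
  [:: [:: 3; 4; 1; 2]; [:: 4; 2; 3; 1];
      [:: 3; 5; 1; 4; 2]; [:: 4; 2; 5; 1; 3]; [:: 4; 5; 3; 1; 2];
      [:: 4; 2; 6; 1; 5; 3]; [:: 4; 6; 3; 1; 5; 2]; [:: 5; 2; 6; 4; 1; 3]].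

Definition tower n (s : 'S_n) : Prop :=
  exists q l : seq nat,
    [/\ q \in tower_bases, size l = size q, all (leq 1) l &
        oneline s = inflation q l].

Inductive pseudosmooth : forall n, 'S_n -> Prop :=
| ps_empty (s : 'S_0) : pseudosmooth s
| ps_one (s : 'S_1) : pseudosmooth s
| ps_tower n (s : 'S_n) :
    1 < n -> ~ decomposable s -> tower s -> pseudosmooth s
| ps_corner n (s : 'S_n) c d m (t : 'S_m) :
    1 < n -> ~ decomposable s -> good_corner s c d ->
    is_deletion s d t -> pseudosmooth t -> pseudosmooth s
| ps_sum n (s : 'S_n) :
    (forall m (t : 'S_m), indecomposable_summand s t -> pseudosmooth t) ->
    pseudosmooth s.

Definition critical n (s : 'S_n) : Prop :=
  ~ pseudosmooth s /\
  forall m (t : 'S_m), m < n -> contains s t -> pseudosmooth t.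

(* Edges of the cycle visiting the vertices of c in cyclic order *)
Definition cycle_edge (T : eqType) (c : seq T) : rel T := fun x y =>
  [&& x \in c, y \in c & (y == next c x) || (x == next c y)].

(* Edges of the path visiting the vertices of p in order *)
Definition path_edge (T : eqType) (p : seq T) : rel T := fun x y =>
  infix [:: x; y] p || infix [:: y; x] p.

(* The graph e on T is the dumbbell made of the cycles c1 and c2 and of the   *)
(* path from a on c1 to b on c2 with internal vertices p.                     *)
Definition dumbbell (T : finType) (e : rel T) (c1 c2 : seq T) (a b : T)
    (p : seq T) : Prop :=
  [/\ 2 < size c1 /\ 2 < size c2,
      uniq (c1 ++ p ++ c2) /\ (forall x : T, x \in c1 ++ p ++ c2),
      a \in c1 /\ b \in c2 &
      forall x y, e x y = [|| cycle_edge c1 x y, cycle_edge c2 x y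
                            | path_edge (a :: rcons p b) x y]].

(* c is a 4-cycle with vertex set C whose edges are the minimal inversions of *)
(* the pattern of s on C.                                                     *)
Definition core_cycle n (s : 'S_n) (C : {set 'I_n}) (c : seq 'I_n) : Prop :=
  [/\ size c = 4, uniq c, c =i C &
      forall x y,
        cycle_edge c x y = min_inversion_on s C x y || min_inversion_on s C y x].

(* Main.v *)
Require Import Defs.
From mathcomp Require Import all_boot all_fingroup.
From mathcomp Require Import zify.

Set Implicit Arguments.
Unset Strict Implicit.
Unset Printing Implicit Defensive.

(** Call a permutation bad when it is indecomposable, has no good corner and is
    not a tower.  Unfolding the recursion for pseudosmoothness, a critical
    permutation is bad and none of its proper patterns is bad ([critical_bad],
    [critical_proper]); nothing else about pseudosmoothness enters.

    A corner that is not good has an ascent in its window.  When neither W nor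
    S is good, the points of their two windows always contain two that complete
    W and S to a pattern 3412 or 4231 ([core_exists]): this is an SW core.  Conversely a
    set of points containing an SW core and an NE core has no good corner.  The
    NE side is the SW side with the orders of positions and of values both
    reversed, so points carry abstract position and value functions [p] and [v],
    and each statement about one side is proved once.

    Suppose that the two cores meet or that an inversion joins them.  Their union is an
    indecomposable pattern on at most 8 < n points, hence a tower.  The corners
    of a tower either form a 3412 or coincide in pairs, W = N and S = E, so four
    points T already serve as both cores.  Every pattern obtained by adding up
    to three points to T is then a tower, and the block of a point is dictated
    by its situation relative to T.  The small towers therefore glue to an
    inflation structure on the whole permutation, which is a contradiction
    ([no_tower3412], [no_tower4231]).

    So no inversion joins the cores, and a shortest path of the inversion graph
    connects them ([connect_splits], [geodesic_exists]).  The cores and the path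
    form an indecomposable pattern without good corners; it is not a tower,
    because in a tower W and E form an inversion ([tower_adj]).  By minimality
    there are no other points.  Minimality also forbids any other core among a
    core and the neighbouring path point z, because the new core would do the
    same job with one point fewer ([no_other_core]).  This makes the core unique
    and leaves six possible positions of z relative to it
    ([attachment_patterns]), in each of which the minimal inversions are those
    of the core together with one inversion between the core and z.  Along the path
    there are no triangles of inversions, so all inversions there are minimal
    ([cov_adj_path]). *)

(** * Points with a position and a value *)

Lemma inj_neq (T : eqType) (f : T -> nat) x y :
  injective f -> x != y -> f x != f y.
Proof. by move=> f_inj; apply: contra_neq => /f_inj. Qed.

Section Points.
Variables (T : finType) (p v : T -> nat).
Implicit Types (C U A : {set T}).

Definition nw x y := (p x < p y) && (v y < v x).
Definition sw x y := (p x < p y) && (v x < v y).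
Definition adj x y := nw x y || nw y x.

(** Only the points of [C] may separate [x] from [y]: with the full set this is
    the relation Cov, with a core it gives the minimal inversions of its pattern. *)
Definition covers C x y :=
  [&& x \in C, y \in C, nw x y & ~~ [exists j in C, nw x j && nw j y]].
Definition cov_adj C x y := covers C x y || covers C y x.

(** A pattern 3412 with letters [w x s y], or 4231 with letters [w x y s], in both
    cases with [w] leftmost and [s] lowest. *)
Definition core w x y s :=
  [&& p w < p x, p x < p y, p x < p s, v s < v y, v y < v w, v s < v x &
      (p s < p y) && (v w < v x) || (p y < p s) && (v x < v y)].

(** [w] and [s] are moreover the W and S corners of the pattern on [U]. *)
Definition core_in U w x y s :=
  [/\ core w x y s, {subset [:: w; x; y; s] <= U} &
      forall t, t \in U -> p w <= p t /\ v s <= v t].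

(** [A] and its complement in [U] are the two summands of a direct sum. *)
Definition splits U A :=
  [/\ A \subset U, exists t, t \in A, exists t, t \in U :\: A &
      {in A & U :\: A, forall t u, sw t u}].

Lemma adjC x y : adj x y = adj y x.
Proof. by rewrite /adj orbC. Qed.

Lemma cov_adjC C x y : cov_adj C x y = cov_adj C y x.
Proof. by rewrite /cov_adj orbC. Qed.

Hypotheses (p_inj : injective p) (v_inj : injective v).

(** If the window of S reaches above W, through [l], and the window of W reaches
    to the right of S, through [j], then [w l s j] is a 3412.  Otherwise one of
    the two ascents lies in both windows and makes a 4231 with W and S. *)
Lemma core_exists w s i j k l :
  (forall t, p w <= p t /\ v s <= v t) ->
  nw w i -> nw w j -> sw i j -> nw k s -> nw l s -> sw k l ->
  exists x y, core w x y s.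
Proof.
move=> lim; rewrite /nw /sw /core => wi wj ij ks ls kl.
have [[[[? ?] [? ?]] [? ?]] [? ?]] := (lim i, lim j, lim k, lim l).
have [wl|lw] := ltnP (v w) (v l).
  have [sj|js] := ltnP (p s) (p j).
    by exists l, j; have nlw : l != w by [apply: contraL wl => /eqP->; lia];
      have := inj_neq p_inj nlw; lia.
  have nis : i != s by apply: contraTN wi => /eqP ?; subst; lia.
  have njs : j != s by apply: contraTN ij => /eqP ?; subst; lia.
  have [? ?] := (inj_neq v_inj nis, inj_neq p_inj njs).
  by exists i, j; lia.
have nlw : l != w by apply: contraTN kl => /eqP ?; subst; lia.
have nkw : k != w by apply: contraTN kl => /eqP ?; subst; lia.
have [? ?] := (inj_neq v_inj nlw, inj_neq p_inj nkw).
by exists k, l; lia.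
Qed.

End Points.

Section OneFrame.
Variables (T : finType) (p v : T -> nat).
Implicit Types (C U A : {set T}).
Hypotheses (p_inj : injective p) (v_inj : injective v).

Lemma core_uniq w x y s : core p v w x y s -> uniq [:: w; x; y; s].
Proof.
move=> cr; rewrite /= !inE !negb_or !andbT; move: cr; rewrite /core => cr.
by apply/and3P; split; first apply/and3P; first split;
   try (apply/andP; split); apply: contraTneq cr => ->; lia.
Qed.

Lemma core_adj w x y s : core p v w x y s ->
  [/\ adj p v w s, adj p v w y & adj p v x s].
Proof. by rewrite /core /adj /nw => cr; split; lia. Qed.

Lemma core_min w x y s t : core p v w x y s -> t \in [:: w; x; y; s] ->
  p w <= p t /\ v s <= v t.
Proof.
rewrite /core !inE => cr.
by case/or4P => /eqP->; split; move: cr; clear; lia.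
Qed.

Lemma adj_neq x y : adj p v x y -> x != y.
Proof. by apply: contraTneq => ->; rewrite /adj /nw; lia. Qed.

Lemma sw_nadj x y : sw p v x y -> adj p v x y = false.
Proof. by rewrite /sw /adj /nw; lia. Qed.

(** Being above and to the right of a whole core only has to be tested on
    inversions: a point neither left of [w] nor below [s] that forms no inversion
    with [w] and [s] lies above [w] and to the right of [s], which rules out that
    it is below [x] or to the left of [y]. *)
Lemma nonadj_above w x y s t :
  core p v w x y s -> t \notin [:: w; x; y; s] -> p w <= p t -> v s <= v t ->
  {in [:: w; x; y; s], forall c, ~~ adj p v c t} ->
  {in [:: w; x; y; s], forall c, sw p v c t}.
Proof.
move=> cr; rewrite !inE !negb_or => /and4P[tw tx ty ts] wt st nadj.
have nw_ := nadj w; have nx := nadj x; have ny := nadj y; have ns := nadj s.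
rewrite !inE ?eqxx ?orbT in nw_ nx ny ns.
have {nw_ nx ny ns} [nw_ nx ny ns] := And4 (nw_ isT) (nx isT) (ny isT) (ns isT).
have pw := inj_neq p_inj tw; have py := inj_neq p_inj ty; have ps := inj_neq p_inj ts.
have vw := inj_neq v_inj tw; have vx := inj_neq v_inj tx; have vs := inj_neq v_inj ts.
move: cr; rewrite /core => /and5P[wx xy xs sy /and3P[yw sx _]].
have lw : v w < v t by clear -nw_ pw wt vw; move: nw_; rewrite /adj /nw; lia.
have ls : p s < p t by clear -ns vs st ps; move: ns; rewrite /adj /nw; lia.
have lx : v x < v t by clear -nx xs ls vx; move: nx; rewrite /adj /nw; lia.
have ly : p y < p t by clear -ny yw lw py; move: ny; rewrite /adj /nw; lia.
by move=> c; rewrite !inE /sw => /or4P[] /eqP->; apply/andP; split; clear -lw ls lx ly wt st wx xy xs sy yw sx pw vs; lia.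
Qed.

Lemma splits_closed U A t u : splits p v U A -> t \in A -> u \in U ->
  adj p v t u -> u \in A.
Proof.
case=> _ _ _ below tA uU; apply: contraTT => uA.
by rewrite sw_nadj // below // inE uA.
Qed.

Lemma splits_path U A t q : splits p v U A -> t \in A -> {subset q <= U} ->
  path (adj p v) t q -> last t q \in A.
Proof.
move=> split_A; elim: q t => //= u q IHq t tA sub /andP[tu uq].
apply: IHq uq; last by move=> i iq; apply: sub; rewrite inE iq orbT.
by apply: splits_closed split_A tA _ tu; apply: sub; rewrite mem_head.
Qed.

(** A core is connected by inversions and contains the W corner, which lies in the
    lower summand. *)
Lemma splits_core U A w x y s : splits p v U A -> core_in p v U w x y s ->
  {subset [:: w; x; y; s] <= A}.
Proof.
move=> split_A [cr sub lim].
have wA : w \in A.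
  have [_ [t tA] _ below] := split_A; apply: contraT => wA.
  have wU : w \in U :\: A by rewrite inE wA sub ?mem_head.
  have /andP[+ _] := below t w tA wU.
  have tU : t \in U by have [/subsetP/(_ t tA)] := split_A.
  by rewrite ltnNge (lim t tU).1.
have [ws wy xs] := core_adj cr.
have inU c : c \in [:: w; x; y; s] -> c \in U by apply: sub.
have sA : s \in A by apply: splits_closed split_A wA _ ws; rewrite inU // !inE eqxx ?orbT.
have yA : y \in A by apply: splits_closed split_A wA _ wy; rewrite inU // !inE eqxx ?orbT.
have xA : x \in A.
  by apply: splits_closed split_A sA _ _; [rewrite inU // !inE eqxx ?orbT | rewrite adjC].
by move=> c; rewrite !inE => /or4P[] /eqP->.
Qed.

End OneFrame.


(** * Reversing both orders *)

(** Reversing positions and values is the rotation by a half turn; it preserves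
    the patterns 3412 and 4231 and swaps W with E and S with N. *)
Definition reversed (T : finType) (p p' : T -> nat) :=
  forall x y, (p' x < p' y) = (p y < p x).

Section TwoFrames.
Variables (T : finType) (p v p' v' : T -> nat).
Implicit Types (C U A : {set T}).
Hypotheses (rev_p : reversed p p') (rev_v : reversed v v').

Lemma reversed_inj (f f' : T -> nat) : injective f -> reversed f f' -> injective f'.
Proof.
move=> f_inj rev_f x y eq_xy; apply: f_inj.
by have := rev_f x y; have := rev_f y x; rewrite eq_xy ltnn; case: ltngtP.
Qed.

Lemma nw_rev x y : nw p' v' x y = nw p v y x.
Proof. by rewrite /nw rev_p rev_v. Qed.

Lemma sw_rev x y : sw p' v' x y = sw p v y x.
Proof. by rewrite /sw rev_p rev_v. Qed.

Lemma adj_rev x y : adj p' v' x y = adj p v x y.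
Proof. by rewrite /adj !nw_rev orbC. Qed.

Lemma covers_rev C x y : covers p' v' C x y = covers p v C y x.
Proof.
rewrite /covers nw_rev andbCA; congr [&& _, _, _ & ~~ _].
by apply: eq_existsb => j; rewrite !nw_rev [nw _ _ _ _ && _]andbC.
Qed.

Lemma cov_adj_rev C x y : cov_adj p' v' C x y = cov_adj p v C x y.
Proof. by rewrite /cov_adj !covers_rev orbC. Qed.

(** When the four corners form a 3412, or W = N and S = E with an ascent between
    them, the same four points are a core at both ends. *)
Lemma cores_of_3412 w n s e : p w < p n -> p n < p s -> p s < p e ->
  v s < v e -> v e < v w -> v w < v n -> core p v w n e s /\ core p' v' e s w n.
Proof. by rewrite /core !rev_p !rev_v; split; lia. Qed.

Lemma cores_of_4231 w x y s : p w < p x -> p x < p y -> p y < p s ->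
  v s < v x -> v x < v y -> v y < v w -> core p v w x y s /\ core p' v' s y x w.
Proof. by rewrite /core !rev_p !rev_v; split; lia. Qed.

Lemma splits_rev U A : splits p v U A -> splits p' v' U (U :\: A).
Proof.
case=> sAU [a aA] [b bU] below; split; first exact: subsetDl.
- by exists b.
- by exists a; rewrite !inE aA (subsetP sAU).
move=> t u tU; rewrite !inE negb_and negbK andb_orl andNb orbF => /andP[uA _].
by rewrite sw_rev below.
Qed.

Lemma splits_cores U A w x y s e x' y' n : splits p v U A ->
  core_in p v U w x y s -> core_in p' v' U e x' y' n ->
  {subset [:: w; x; y; s] <= A} /\ {in [:: e; x'; y'; n], forall c, c \notin A}.
Proof.
move=> split_A cr cr'; split; first exact: splits_core split_A cr.
by move=> c /(splits_core (splits_rev split_A) cr'); rewrite inE => /andP[].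
Qed.

End TwoFrames.

(** * Shortest paths *)

(** The interior [q] of a shortest path from [A] to [B], described by the absence
    of shortcuts: no chord, and only the ends of [q] are adjacent to [A] and [B]. *)
Definition geodesic (T : finType) (e : rel T) (A B : {set T}) (q : seq T) :=
  [/\ uniq q /\ {in q, forall x, x \notin A :|: B},
      {in q &, forall x y, e x y =
         (index y q == (index x q).+1) || (index x q == (index y q).+1)},
      {in A & q, forall c x, e c x -> index x q = 0},
      {in B & q, forall c x, e c x -> (index x q).+1 = size q} &
      exists c b, [/\ c \in A, b \in B & path e c (rcons q b)]].

(** Among the paths from [A] to [B] one with the least number of interior points
    works, since each property that fails yields a shorter path. *)
Lemma geodesic_exists (T : finType) (e : rel T) (A B : {set T}) c b :
  symmetric e -> irreflexive e -> [disjoint A & B] ->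
  c \in A -> b \in B -> connect e c b ->
  exists q, geodesic e A B q.
Proof.
move=> sym_e irr_e disjAB cA bB /connectP[q0 q0P lastq0].
pose walk k := [exists c in A, exists t : k.-tuple T, exists b in B,
                path e c (rcons t b)].
have walkP k : reflect (exists c q b, [/\ c \in A, b \in B, size q = k &
                                          path e c (rcons q b)]) (walk k).
  apply: (iffP existsP).
    case=> c1 /andP[c1A /existsP[t /existsP[b1 /andP[b1B H]]]].
    by exists c1, t, b1; rewrite size_tuple.
  case=> c1 [q [b1 [c1A b1B /eqP szq H]]]; exists c1; rewrite c1A /=.
  by apply/existsP; exists (Tuple szq); apply/existsP; exists b1; rewrite b1B.
have ex_walk : exists k, walk k.
  case/lastP: q0 => [|q b1] in q0P lastq0.
    by move/(disjointFr disjAB)/negP: cA; rewrite -[c]lastq0 bB.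
  exists (size q); apply/walkP; exists c, q, b; split=> //.
  by rewrite lastq0 last_rcons.
case: (ex_minnP ex_walk) => k /walkP[c1 [q [b1 [c1A b1B szq qP]]]] min_k.
have {}min_k c2 q2 b2 : c2 \in A -> b2 \in B -> path e c2 (rcons q2 b2) ->
    size q <= size q2.
  by move=> c2A b2B q2P; rewrite szq; apply: min_k; apply/walkP; exists c2, q2, b2.
(* the path broken at its i-th interior point, ready to be rejoined elsewhere *)
have cut i : i < size q -> [/\ path e c1 (take i q),
    e (last c1 (take i q)) (nth b1 q i), path e (nth b1 q i) (rcons (drop i.+1 q) b1) &
    size (drop i.+1 q) = size q - i.+1].
  move=> lti; move: qP; rewrite -{1}(cat_take_drop i q) (drop_nth b1) //.
  by rewrite rcons_cat cat_path /= size_drop => /and3P[].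
have takeS i : i < size q -> path e c1 (rcons (take i q) (nth b1 q i)).
  by move=> /cut[? ? _ _]; rewrite rcons_path; apply/andP.
have sz_take i : i < size q -> size (take i q) = i.
  by move=> lti; rewrite size_takel // ltnW.
have uniq_q : uniq q.
  apply/(uniqPn b1) => -[i [j [ltij ltj eq_ij]]].
  have lti := ltn_trans ltij ltj; have [ti ei _ _] := cut i lti.
  have [_ _ dj szj] := cut j ltj.
  have := min_k c1 (take i q ++ nth b1 q j :: drop j.+1 q) b1 c1A b1B.
  rewrite rcons_cat cat_path /= -{1}eq_ij ei dj !andbT size_cat /= sz_take // szj.
  by move=> /(_ ti) le_q; have {}ltj : j < size q := ltj; clear -le_q ltij ltj; lia.
have chord i j : i < j -> j < size q -> e (nth b1 q i) (nth b1 q j) -> j = i.+1.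
  move=> ltij ltj e_ij; have lti := ltn_trans ltij ltj.
  have [_ _ dj szj] := cut j ltj.
  have := min_k c1 (rcons (take i q) (nth b1 q i) ++ nth b1 q j :: drop j.+1 q) b1 c1A b1B.
  rewrite rcons_cat cat_path /= takeS // last_rcons e_ij dj size_cat size_rcons /=.
  by rewrite sz_take // szj => /(_ isT); clear -ltij ltj; lia.
have step i : i.+1 < size q -> e (nth b1 q i) (nth b1 q i.+1).
  move=> lti; have [_ + _ _] := cut i.+1 lti.
  by rewrite (take_nth b1) ?last_rcons // ltnW.
have idx x : x \in q -> exists2 i, i < size q & x = nth b1 q i.
  by case/(nthP b1) => i lti <-; exists i.
exists q; split; last by exists c1; exists b1.
- split=> // x /idx[i lti ->]; rewrite inE negb_or; apply/andP; split; apply/negP.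
    move=> xA; have [_ _ di szi] := cut i lti.
    by have := min_k _ _ _ xA b1B di; rewrite szi; clear -lti; lia.
  move=> xB; have [ti ei _ szi] := cut i lti.
  by have := min_k c1 (take i q) _ c1A xB (takeS i lti); rewrite sz_take //; clear -lti; lia.
- move=> x y /idx[i lti ->] /idx[j ltj ->]; rewrite !index_uniq //.
  apply/idP/idP.
    have [ltij|ltji|->] := ltngtP i j; last by rewrite irr_e.
      by move/(chord _ _ ltij ltj) ->; rewrite eqxx.
    by rewrite sym_e => /(chord _ _ ltji lti) ->; rewrite eqxx orbT.
  by case/orP => /eqP E; subst; [|rewrite sym_e]; apply: step.
- move=> c2 x c2A /idx[i lti ->] ec; rewrite index_uniq //.
  have [_ _ di szi] := cut i lti.
  have := min_k c2 (nth b1 q i :: drop i.+1 q) b1 c2A b1B.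
  by rewrite /= ec di szi => /(_ isT); clear -lti; lia.
move=> b2 x b2B /idx[i lti ->] eb; rewrite index_uniq //.
have := min_k c1 (rcons (take i q) (nth b1 q i)) b2 c1A b2B.
rewrite rcons_path takeS // last_rcons sym_e eb size_rcons sz_take //.
by move=> /(_ isT); clear -lti; lia.
Qed.

Lemma index_rev (T : eqType) (q : seq T) x : uniq q -> x \in q ->
  index x (rev q) = size q - (index x q).+1.
Proof.
move=> Uq /(nthP x)[i lti <-]; rewrite [in RHS]index_uniq //.
have lt : size q - i.+1 < size (rev q) by rewrite size_rev; clear -lti; lia.
have -> : nth x q i = nth x (rev q) (size q - i.+1).
  have lt' : size q - i.+1 < size q by move: lt; rewrite size_rev.
  by rewrite nth_rev // subnSK // subKn // ltnW.
by rewrite index_uniq // rev_uniq.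
Qed.

Lemma geodesic_rev (T : finType) (e : rel T) (A B : {set T}) q : symmetric e ->
  geodesic e A B q -> geodesic e B A (rev q).
Proof.
move=> sym_e [[Uq qAB] step headq lastq [c [b [cA bB qP]]]].
have lt x : x \in q -> index x q < size q by rewrite index_mem.
split.
- by split=> [|x]; rewrite ?rev_uniq // mem_rev setUC; apply: qAB.
- move=> x y; rewrite !mem_rev => xq yq; rewrite step // !index_rev //.
  by move: (index x q) (index y q) (size q) (lt x xq) (lt y yq); clear; lia.
- move=> t x tB; rewrite mem_rev => xq /(lastq _ _ tB xq) H.
  by rewrite index_rev // H subnn.
- move=> t x tA; rewrite mem_rev => xq /(headq _ _ tA xq) H.
  by rewrite index_rev // H size_rev; move: (index x q) (size q) (lt x xq); clear; lia.
exists b, c; split=> //.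
have := rev_path e c (rcons q b); rewrite last_rcons belast_rcons rev_cons => ->.
by rewrite (eq_path (e' := e)) // => x y; apply: sym_e.
Qed.

(** * Covers read off a word *)

Lemma cycle_edge4 (T : eqType) (a b c d t u : T) : uniq [:: a; b; c; d] ->
  cycle_edge [:: a; b; c; d] t u =
  ((t, u) \in [:: (a, b); (b, c); (c, d); (d, a)]) ||
  ((u, t) \in [:: (a, b); (b, c); (c, d); (d, a)]).
Proof.
rewrite /= !inE !negb_or !xpair_eqE /cycle_edge !inE /=.
case/and4P=> /and3P[ab ac ad] /andP[bc bd] cd _.
have E := (negbTE ab, negbTE ac, negbTE ad, negbTE bc, negbTE bd, negbTE cd).
have E' : ((b == a = false) * (c == a = false) * (d == a = false) *
  (c == b = false) * (d == b = false) * (d == c = false))%type.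
  by rewrite ![b == _]eq_sym ![c == _]eq_sym ![d == _]eq_sym !E.
have [->|ta] := eqVneq t a; last have [->|tb] := eqVneq t b;
  last have [->|tc] := eqVneq t c; last have [->|td] := eqVneq t d;
  rewrite ?eqxx ?E ?E' //= ?andbF ?orbF //;
  (have [ua|ua] := eqVneq u a; last have [ub|ub] := eqVneq u b;
  last have [uc|uc] := eqVneq u c; last have [ud|ud] := eqVneq u d);
  rewrite ?ua ?ub ?uc ?ud ?eqxx ?E ?E' //= ?eqxx ?E ?E' ?andbF ?orbF //.
Qed.

(** The same notions for the points of a finite list, replaced by their indices:
    [P] and [V] list any numbers ordered like the positions and the values, so
    that a question about covers becomes a computation. *)
Definition word_nw (P V : seq nat) i k :=
  (nth 0 P i < nth 0 P k) && (nth 0 V k < nth 0 V i).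
Definition word_cov P V m i k :=
  word_nw P V i k && ~~ has (fun j => word_nw P V i j && word_nw P V j k) (iota 0 m).
Definition word_cov_adj P V m i k := word_cov P V m i k || word_cov P V m k i.

Section Coding.
Variables (T : finType) (p v : T -> nat).

Definition coded (t0 : T) (pts : seq T) (P V : seq nat) :=
  forall i k, i < size pts -> k < size pts ->
    (p (nth t0 pts i) < p (nth t0 pts k)) = (nth 0 P i < nth 0 P k) /\
    (v (nth t0 pts i) < v (nth t0 pts k)) = (nth 0 V i < nth 0 V k).

Lemma cov_adj_coded t0 pts P V m (C : {set T}) i k :
  coded t0 pts P V -> m <= size pts -> C =i take m pts -> i < m -> k < m ->
  cov_adj p v C (nth t0 pts i) (nth t0 pts k) = word_cov_adj P V m i k.
Proof.
move=> cod le_m defC.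
suff cov a b : a < m -> b < m ->
    covers p v C (nth t0 pts a) (nth t0 pts b) = word_cov P V m a b.
  by move=> lti ltk; rewrite /cov_adj !cov.
have nwE c d : c < m -> d < m ->
    nw p v (nth t0 pts c) (nth t0 pts d) = word_nw P V c d.
  move=> ltc ltd; have [ltc' ltd'] := (leq_trans ltc le_m, leq_trans ltd le_m).
  by rewrite /nw (cod c d ltc' ltd').1 (cod d c ltd' ltc').2.
have inC c : c < m -> nth t0 pts c \in C.
  by move=> ltc; rewrite defC -(nth_take _ ltc) mem_nth // size_takel.
move=> lta ltb; rewrite /covers /word_cov !inC //= nwE //; congr (_ && ~~ _).
apply/existsP/hasP => [[j /andP[jC]] | [j]].
  move: jC; rewrite defC => /(nthP t0)[c]; rewrite size_takel // => ltc <-.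
  rewrite nth_take // !nwE // => H; exists c => //; by rewrite mem_iota.
by rewrite mem_iota /= => ltj H; exists (nth t0 pts j); rewrite inC // !nwE.
Qed.


(** The local shape of the cover graph around a core [C] followed by [z]: the core
    contributes the cycle [cyc], [a] is the only point of [C] covered with [z]. *)
Definition junction (C : {set T}) z cyc a :=
  [/\ [/\ size cyc = 4, uniq cyc, cyc =i C & a \in C],
      forall t u, cycle_edge cyc t u = cov_adj p v C t u,
      {in C &, forall t u, cov_adj p v setT t u = cov_adj p v C t u} &
      {in C, forall t, cov_adj p v setT t z = (t == a)}].

(** A point separating the ends of an inversion forms an inversion with both ends,
    so only the neighbours of one end have to be inspected. *)
Lemma cov_adj_local (C D : {set T}) c d :
  c \in C -> C \subset D -> d \in D ->
  (forall t, t \notin D -> ~~ adj p v c t) ->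
  cov_adj p v setT c d = cov_adj p v D c d.
Proof.
move=> cC sCD dD far; have cD := subsetP sCD _ cC.
rewrite /cov_adj /covers !inE cD dD /=; congr (_ && ~~ _ || _ && ~~ _);
  apply/existsP/existsP => -[j H]; exists j; move: H; rewrite ?inE /=.
- move=> /andP[cj ->]; rewrite cj !andbT.
  by apply: contraTT cj => /far; rewrite /adj negb_or => /andP[].
- by case/andP.
- move=> /andP[-> jc]; rewrite jc !andbT.
  by apply: contraTT jc => /far; rewrite /adj negb_or => /andP[].
- by case/andP.
Qed.

(** Everything claimed by a junction concerns five points, so it can be checked by
    evaluating a boolean on their codes. *)
Lemma junction_coded (C : {set T}) t0 pts P V idx a :
  size pts = 5 -> uniq pts -> coded t0 pts P V -> C =i take 4 pts ->
  (forall c t, c \in C -> t \notin pts -> ~~ adj p v c t) ->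
  [&& perm_eq idx (iota 0 4), a < 4,
      all (fun i => all (fun k => (cycle_edge idx i k == word_cov_adj P V 4 i k) &&
        (word_cov_adj P V 5 i k == word_cov_adj P V 4 i k)) (iota 0 4)) (iota 0 4) &
      all (fun i => word_cov_adj P V 5 i 4 == (i == a)) (iota 0 4)] ->
  junction C (nth t0 pts 4) [seq nth t0 pts i | i <- idx] (nth t0 pts a).
Proof.
move=> sz_pts Upts cod defC far /and4P[Pidx lta4 Hcyc Ha].
have inC i : i < 4 -> nth t0 pts i \in C.
  by move=> lti; rewrite defC -(nth_take _ lti) mem_nth // size_takel // sz_pts.
have CP t : t \in C -> exists2 i, i < 4 & t = nth t0 pts i.
  rewrite defC => /(nthP t0)[i]; rewrite size_takel ?sz_pts // => lti <-.
  by exists i; rewrite ?nth_take.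
pose D := [set t in pts].
have cov_adjT i k : i < 4 -> k < 5 ->
    cov_adj p v setT (nth t0 pts i) (nth t0 pts k) = word_cov_adj P V 5 i k.
  move=> lti ltk; rewrite (@cov_adj_local C D) ?inC //.
  - by apply: cov_adj_coded cod _ _ _ _; rewrite ?sz_pts // ?(leq_trans lti) //
      => t; rewrite inE -sz_pts take_size.
  - by apply/subsetP=> t; rewrite defC inE; apply: mem_take.
  - by rewrite inE mem_nth ?sz_pts.
  by move=> t; rewrite inE; apply: far; apply: inC.
have cov_adjC4 i k : i < 4 -> k < 4 ->
    cov_adj p v C (nth t0 pts i) (nth t0 pts k) = word_cov_adj P V 4 i k.
  by move=> lti ltk; apply: cov_adj_coded cod _ _ _ _; rewrite ?sz_pts.
have szidx : size idx = 4 by rewrite (perm_size Pidx).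
have idx4 i : i \in idx -> i < 4 by rewrite (perm_mem Pidx) mem_iota.
have nth_inj i k : i < 4 -> k < 4 -> (nth t0 pts i == nth t0 pts k) = (i == k).
  by move=> lti ltk; rewrite nth_uniq // sz_pts ltnW.
have Uc : uniq [seq nth t0 pts i | i <- idx].
  rewrite map_inj_in_uniq ?(perm_uniq Pidx) ?iota_uniq //.
  by move=> i k /idx4 lti /idx4 ltk /eqP; rewrite nth_inj // => /eqP.
have memc : [seq nth t0 pts i | i <- idx] =i C.
  move=> t; apply/mapP/idP => [[i /idx4 lti ->] | /CP[i lti ->]]; first exact: inC.
  by exists i; rewrite // (perm_mem Pidx) mem_iota.
split.
- by split; rewrite ?size_map ?szidx ?inC.
- move=> t u; have [tC|tC] := boolP (t \in C); last first.
    by rewrite /cycle_edge memc (negbTE tC) /cov_adj /covers (negbTE tC) andbF.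
  have [uC|uC] := boolP (u \in C); last first.
    by rewrite /cycle_edge !memc (negbTE uC) /cov_adj /covers (negbTE uC) !andbF.
  have [[i lti ->] [k ltk ->]] := (CP t tC, CP u uC).
  rewrite cov_adjC4 //; have /allP/(_ k) := allP Hcyc i ltac:(by rewrite mem_iota).
  rewrite mem_iota => /(_ ltk)/andP[/eqP<- _].
  have Uidx : uniq idx by rewrite (perm_uniq Pidx) iota_uniq.
  move: szidx idx4 Uidx Uc; case: idx {Pidx Hcyc memc} => // i0 [//|i1[//|i2[//|i3[|//]]]].
  move=> _ idx4 Uidx Uc; rewrite /= !cycle_edge4 // !inE !xpair_eqE.
  by rewrite !nth_inj // idx4 // !inE eqxx ?orbT.
- move=> t u /CP[i lti ->] /CP[k ltk ->]; rewrite cov_adjT // 1?ltnW // cov_adjC4 //.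
  have /allP/(_ k) := allP Hcyc i ltac:(by rewrite mem_iota).
  by rewrite mem_iota => /(_ ltk)/andP[_ /eqP].
- move=> t /CP[i lti ->]; rewrite cov_adjT // nth_inj //.
  by apply/eqP; apply: (allP Ha); rewrite mem_iota.
Qed.

End Coding.

(** * How the path leaves a core *)

(** Codes of the points [w x y s z]: the words 34152 and 35124 extend a core 3412
    and the words 42531, 42351, 52413 and 52314 extend a core 4231. *)
Definition attachments : seq (seq nat * seq nat) := [::
  ([:: 0; 1; 4; 2; 3], [:: 3; 4; 2; 1; 5]);
  ([:: 0; 1; 3; 2; 4], [:: 3; 5; 2; 1; 4]);
  ([:: 0; 1; 3; 4; 2], [:: 4; 2; 3; 1; 5]);
  ([:: 0; 1; 2; 4; 3], [:: 4; 2; 3; 1; 5]);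
  ([:: 0; 1; 2; 3; 4], [:: 5; 2; 4; 1; 3]);
  ([:: 0; 1; 2; 3; 4], [:: 5; 2; 3; 1; 4])].

Ltac decode := by case=> [|[|[|[|[|i]]]]] // [|[|[|[|[|k]]]]] // _ _; split=> /=; lia.

Section Attach.
Variables (T : finType) (p v : T -> nat).
Hypotheses (p_inj : injective p) (v_inj : injective v).

(** The path goes on from [z] to a point above and to the right of the core,
    so [z] is above the whole core or to the right of all of it.  Of these positions
    of [z] the last hypothesis leaves six: in the others, putting [z] in place of
    a core point produces a 3412 or a 4231. *)
Lemma attachment_patterns w x y s z r :
  core p v w x y s -> z \notin [:: w; x; y; s] -> p w < p z -> v s < v z ->
  {in [:: w; x; y; s], forall c, sw p v c r} -> adj p v z r ->
  has (adj p v z) [:: w; x; y; s] ->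
  (forall w' x' y' s', {subset [:: w'; x'; y'; s'] <= [:: z; w; x; y; s]} ->
     core p v w' x' y' s' -> z \notin [:: w'; x'; y'; s']) ->
  exists2 PV : seq nat * seq nat, coded p v w [:: w; x; y; s; z] PV.1 PV.2 &
    PV \in attachments.
Proof.
move=> cr; rewrite !inE !negb_or => /and4P[zw zx zy zs] pwz vsz far zr near crit.
have {crit} crit w' x' y' s' :
    core p v w' x' y' s' -> {subset [:: w'; x'; y'; s'] <= [:: z; w; x; y; s]} ->
    z \notin [:: w'; x'; y'; s'] by move=> ? ?; apply: crit.
have sub w' x' y' s' : all (mem [:: z; w; x; y; s]) [:: w'; x'; y'; s'] ->
    z \in [:: w'; x'; y'; s'] -> core p v w' x' y' s' = false.
  move=> /allP sub zin; apply/negP => cr'.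
  by move: (crit _ _ _ _ cr' sub); rewrite zin.
have no1 : core p v w x y z = false by apply: sub; rewrite /= !inE !eqxx ?orbT.
have no2 : core p v w x z s = false by apply: sub; rewrite /= !inE !eqxx ?orbT.
have no3 : core p v w z y s = false by apply: sub; rewrite /= !inE !eqxx ?orbT.
have no4 : core p v z x y s = false by apply: sub; rewrite /= !inE !eqxx ?orbT.
(* z forms an inversion with r, which is above and to the right of the core *)
have {sub crit} far' : (p y < p z) && (p x < p z) && (p s < p z) || (v y < v z) && (v x < v z) && (v w < v z).
  have farw := far w; have farx := far x; have fary := far y; have fars := far s.
  move: farw farx fary fars zr; rewrite !inE !eqxx !orbT /=.
  move=> /(_ isT) farw /(_ isT) farx /(_ isT) fary /(_ isT) fars.
  move: farw farx fary fars; rewrite /adj /sw /nw.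
  have := (inj_neq p_inj zx, inj_neq p_inj zy, inj_neq p_inj zs, inj_neq v_inj zw,
    inj_neq v_inj zx, inj_neq v_inj zy).
  by move=> [[[[[? ?] ?] ?] ?] ?]; move: cr; rewrite /core; lia.
clear far zr r.
have nz := (inj_neq p_inj zx, inj_neq p_inj zy, inj_neq p_inj zs, inj_neq v_inj zw,
    inj_neq v_inj zx, inj_neq v_inj zy).
case: nz => [[[[[px py] ps] vw] vx] vy]; clear zw zx zy zs.
have pick P V : coded p v w [:: w; x; y; s; z] P V -> (P, V) \in attachments ->
    exists2 PV : seq nat * seq nat, coded p v w [:: w; x; y; s; z] PV.1 PV.2 &
                                    PV \in attachments.
  by move=> cod PVin; exists (P, V).
move: near; rewrite /= /adj /nw orbF => near.
move: no1 no2 no3 no4 cr; rewrite /core => no1 no2 no3 no4.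
case/and5P=> wx xy xs sy /and3P[yw sx /orP[/andP[sy' wx'] | /andP[sy' wx']]];
  case/orP: far' => /andP[/andP[yz xz] sz].
(* a core 3412 with z on its right: the code is 35124 *)
- have [zw|wz] := ltnP (v z) (v w); first by clear -zw no2 wx xs sz sy wx' vsz; lia.
  clear no1 no2 no3 no4.
  have {}wz : v w < v z by rewrite ltn_neqAle eq_sym vw.
  have zx : v z < v x by clear -vsz pwz near yz xz sz vx sy yw wx wz wx' sy'; lia.
  clear near; apply: (pick [:: 0; 1; 3; 2; 4] [:: 3; 5; 2; 1; 4]) => //.
  clear pick; decode.
(* a core 3412 with z above it: the code is 34152 *)
- have [zs|{}sz'] := ltnP (p z) (p s).
    by clear -no3 pwz zs sy sx yw vsz wx' sy' xz yz sz wx xy xs; lia.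
  clear no1 no2 no3 no4.
  have {}sz' : p s < p z by rewrite ltn_neqAle eq_sym ps.
  have zy : p z < p y by clear -vsz pwz near py wx xs xy sy' sz' yz xz sz; lia.
  clear near; apply: (pick [:: 0; 1; 4; 2; 3] [:: 3; 4; 2; 1; 5]) => //.
  clear pick; decode.
(* a core 4231 with z on its right: the codes are 52413 and 52314 *)
- have [zx|xz'] := ltnP (v z) (v x).
    by clear -no1 wx xy xs zx vsz wx' yw sz yz xz sy'; lia.
  clear no1 no2 no3 no4.
  have {}xz' : v x < v z by rewrite ltn_neqAle eq_sym vx.
  have zw : v z < v w by clear -vsz pwz near vw yz xz sz wx xy xs sy yw sx wx' sy' xz'; lia.
  clear near.
  have [zy|{}yz'] := ltnP (v z) (v y).
    apply: (pick [:: 0; 1; 2; 3; 4] [:: 5; 2; 4; 1; 3]) => //.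
    clear pick; decode.
  have {}yz' : v y < v z by rewrite ltn_neqAle eq_sym vy.
  apply: (pick [:: 0; 1; 2; 3; 4] [:: 5; 2; 3; 1; 4]) => //.
  clear pick; decode.
(* a core 4231 with z above it: the codes are 42531 and 42351 *)
- have [zx|xz'] := ltnP (p z) (p x).
    by clear -no4 no3 pwz zx xy xs sy sy' sx wx' yw yz xz sz; lia.
  clear no1 no2 no3 no4.
  have {}xz' : p x < p z by rewrite ltn_neqAle eq_sym px.
  have zs : p z < p s by clear -vsz pwz near ps yz xz sz wx xy xs sy yw sx wx' sy' xz'; lia.
  clear near.
  have [zy|{}yz'] := ltnP (p z) (p y).
    apply: (pick [:: 0; 1; 3; 4; 2] [:: 4; 2; 3; 1; 5]) => //.
    clear pick; decode.
  have {}yz' : p y < p z by rewrite ltn_neqAle eq_sym py.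
  apply: (pick [:: 0; 1; 2; 4; 3] [:: 4; 2; 3; 1; 5]) => //.
  clear pick; decode.
Qed.

Lemma attachment_junction (C : {set T}) w x y s z r :
  core p v w x y s -> C =i [:: w; x; y; s] ->
  z \notin C -> p w < p z -> v s < v z ->
  {in C, forall c, sw p v c r} -> adj p v z r ->
  (exists2 c, c \in C & adj p v z c) ->
  (forall c t, c \in C -> t \notin z |: C -> ~~ adj p v c t) ->
  (forall w' x' y' s', {subset [:: w'; x'; y'; s'] <= z |: C} ->
     core p v w' x' y' s' -> z \notin [:: w'; x'; y'; s']) ->
  exists cyc a, junction p v C z cyc a.
Proof.
move=> cr defC zC pwz vsz far zr [c0 c0C zc0] loc crit.
have memz t : (t \in z |: C) = (t \in [:: z; w; x; y; s]).
  by rewrite !inE defC !inE.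
case: (@attachment_patterns w x y s z r) => //.
- by rewrite -defC.
- by move=> c; rewrite -defC; apply: far.
- by apply/hasP; exists c0; rewrite -?defC.
- by move=> w' x' y' s' sub; apply: crit => t /sub; rewrite memz.
move=> [P V] /= cod PV.
have Upts : uniq [:: w; x; y; s; z].
  by rewrite -(rot_uniq 4) cons_uniq (core_uniq cr) andbT -defC.
have loc' c t : c \in C -> t \notin [:: w; x; y; s; z] -> ~~ adj p v c t.
  move=> cC tn; apply: loc => //; apply: contra tn.
  by rewrite memz !inE orbC !orbA.
have junc := @junction_coded T p v C w _ P V _ _ _ Upts cod defC loc'.
move: PV; rewrite !inE => /or4P[/eqP[? ?]|/eqP[? ?]|/eqP[? ?]|/or3P[/eqP[? ?]|/eqP[? ?]|/eqP[? ?]]]; subst P V.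
- by do 2!eexists; apply: (junc [:: 0; 3; 1; 2] 2).
- by do 2!eexists; apply: (junc [:: 0; 3; 1; 2] 1).
- by do 2!eexists; apply: (junc [:: 0; 1; 3; 2] 2).
- by do 2!eexists; apply: (junc [:: 0; 1; 3; 2] 3).
- by do 2!eexists; apply: (junc [:: 0; 1; 3; 2] 2).
- by do 2!eexists; apply: (junc [:: 0; 1; 3; 2] 0).
Qed.

End Attach.

(** * One end of the graph *)

Section OneSide.
Variables (T : finType) (p v p' v' : T -> nat).
Implicit Types (U A : {set T}).
Hypotheses (p_inj : injective p) (v_inj : injective v).
Hypotheses (rev_p : reversed p p') (rev_v : reversed v v').

(** What criticality says about proper subsets with a core at each end: the pattern
    there, unless it decomposes, is a tower, and in a tower W and E form an
    inversion, as do S and N. *)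
Definition proper_sets_tight :=
  forall U w x y s e x' y' n, U != setT ->
    core_in p v U w x y s -> core_in p' v' U e x' y' n ->
    (forall A, ~ splits p v U A) -> adj p v w e /\ adj p v s n.

Variables (C C' : {set T}) (w x y s e x' y' n z : T) (q : seq T).
Hypotheses (core_C : core_in p v setT w x y s) (defC : C =i [:: w; x; y; s]).
Hypotheses (core_C' : core_in p' v' setT e x' y' n) (defC' : C' =i [:: e; x'; y'; n]).
Hypotheses (disj : [disjoint C & C']) (nadjCC' : {in C & C', forall c c', ~~ adj p v c c'}).
Hypotheses (geo : geodesic (adj p v) C C' (z :: q)).
Hypotheses (full : forall t, [|| t \in C, t \in z :: q | t \in C']).
Hypothesis (minimal : proper_sets_tight).

Let cr : core p v w x y s. Proof. by case: core_C. Qed.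

Lemma head_notin : z \notin C.
Proof.
have [[_ qn] _ _ _ _] := geo.
by have := qn z (mem_head _ _); rewrite inE negb_or => /andP[].
Qed.

Lemma outside_nadj c t : c \in C -> t \notin z |: C -> ~~ adj p v c t.
Proof.
move=> cC; rewrite !inE negb_or => /andP[tz tC].
have [_ _ headq _ _] := geo.
case/or3P: (full t) => [tC'|tq|tC']; first by rewrite tC' in tC.
  by apply/negP => /(headq _ _ cC tq) /=; rewrite eq_sym (negbTE tz).
exact: nadjCC'.
Qed.

(** Beyond [z] nothing is adjacent to the core, so the rest of the permutation sits
    above and to the right of it. *)
Lemma outside_above c t : c \in C -> t \notin z |: C -> sw p v c t.
Proof.
move=> cC tn; have [_ _ lim] := core_C.
have [wt st] := lim t (in_setT t).
have tC : t \notin [:: w; x; y; s].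
  by rewrite -defC; apply: contra tn; rewrite inE orbC => ->.
apply: (nonadj_above p_inj v_inj cr tC wt st); last by rewrite -defC.
by move=> c1; rewrite -defC => c1C; apply: outside_nadj.
Qed.

(** A core using [z] and three points of [C] makes the fourth point [d] of [C]
    superfluous: without [d] there is still a core at each end, and the path still
    connects them.  So each of the corners W and S of the new core forms an
    inversion with a point of [C'].  But one of the two is still in [C], from which no
    inversion leads to [C']. *)
Lemma no_other_core w' x1 y1 s' :
  {subset [:: w'; x1; y1; s'] <= z |: C} -> core p v w' x1 y1 s' ->
  z \notin [:: w'; x1; y1; s'].
Proof.
move=> sub cr1; apply/negP => zL; set L := [:: _; _; _; _] in sub zL.
have UL : uniq L := core_uniq cr1.
have cardC : #|C| = 4.
  by rewrite (eq_card defC); apply/card_uniqP; apply: core_uniq cr.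
have /eqP/cards1P[d defD] : #|(z |: C) :\: [set t in L]| = 1.
  rewrite cardsD (setIidPr _); last by apply/subsetP => t; rewrite inE => /sub.
  by rewrite cardsU1 head_notin cardC cardsE (card_uniqP UL).
have : d \in (z |: C) :\: [set t in L] by rewrite defD set11.
rewrite in_setD in_set in_setU1 => /andP[dL dzC].
have dz : d != z by apply: contraNneq dL => ->.
have dC : d \in C by move: dzC; rewrite (negbTE dz).
have memL t : t \in z |: C -> t != d -> t \in L.
  move=> tC; apply: contraNT => tL.
  by rewrite -in_set1 -defD in_setD in_set tL.
have memLC t : t \in L -> t != z -> t \in C.
  by move=> /sub; rewrite !inE => /orP[->|].
pose U := [set~ d].
have core1 : core_in p v U w' x1 y1 s'.
  split=> // [t tL|t]; first by rewrite !inE; apply: contraNneq dL => <-.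
  rewrite !inE => td; have [tC|tC] := boolP (t \in z |: C).
    by apply: core_min cr1 _; apply: memL.
  have lt c : c \in L -> c != z -> sw p v c t.
    by move=> cL cz; apply: outside_above => //; apply: memLC.
  have := UL; rewrite /= !inE !negb_or => /and4P[/and3P[wx wy ws] /andP[xy xs] ys _].
  move: cr1; rewrite /core => /and5P[pwx pxy pxs vsy _]; split; apply: ltnW.
    have [w'z|w'z] := eqVneq w' z; last by have /andP[] := lt w' (mem_head _ _) w'z.
    have /andP[+ _] : sw p v x1 t by apply: lt; rewrite ?inE ?eqxx ?orbT // -w'z eq_sym.
    exact: ltn_trans.
  have [s'z|s'z] := eqVneq s' z; last first.
    by have /andP[] : sw p v s' t by apply: lt => //; rewrite !inE eqxx !orbT.
  have /andP[_] : sw p v y1 t by apply: lt; rewrite ?inE ?eqxx ?orbT // -s'z.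
  exact: ltn_trans.
have core2 : core_in p' v' U e x' y' n.
  have [cr2 _ lim] := core_C'; split=> // [t|t _]; last exact: lim.
  by rewrite -defC' !inE => tC'; apply: contraTneq tC' => ->; rewrite (disjointFr disj).
have neU : U != setT.
  by apply/eqP => /setP/(_ d); rewrite !inE eqxx.
have w'L : w' \in L by rewrite mem_head.
have s'L : s' \in L by rewrite !inE eqxx !orbT.
have w's : w' != s' by have := UL; rewrite /= !inE !negb_or => /and4P[/and3P[]].
have nC : n \in C' by rewrite defC' !inE eqxx !orbT.
have eC : e \in C' by rewrite defC' mem_head.
case: (minimal neU core1 core2) => [A split_A|we sn]; last first.
  have [w'z|w'z] := eqVneq w' z; last by move/negP: (nadjCC' (memLC _ w'L w'z) eC).
  have s'z : s' != z by rewrite -w'z eq_sym.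
  by move/negP: (nadjCC' (memLC _ s'L s'z) nC).
have [sLA sA'] := splits_cores rev_p rev_v split_A core1 core2.
have [[_ qn] _ _ _ [c [b [cC bC' /=]]]] := geo.
rewrite rcons_path /= => /and3P[_ zq qb].
have inU t : t \in rcons q b -> t \in U.
  rewrite mem_rcons !inE => /orP[/eqP->|tq].
    by apply: contraTneq bC' => ->; rewrite (disjointFr disj).
  have := qn t; rewrite !inE tq orbT negb_or => /(_ isT)/andP[tC _].
  by apply: contraNneq tC => ->.
have zA : z \in A by apply: sLA.
have := splits_path split_A zA inU; rewrite rcons_path zq qb last_rcons => /(_ isT).
by move=> bA; move: (sA' b); rewrite -defC' bC' bA => /(_ isT).
Qed.

Lemma side_junction : exists cyc a, junction p v C z cyc a.
Proof.
have [_ _ lim] := core_C.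
have zC := head_notin.
have zneq c : c \in C -> z != c by move=> cC; apply: contraNneq zC => ->.
have [[/= /andP[zq _] qn] _ _ _ [c [b [cC bC' /= /andP[cz zqb]]]]] := geo.
have [r rn zr] : exists2 r, r \notin z |: C & adj p v z r.
  case: q zq zqb qn => [_ /andP[zb _] _|r q' rq /andP[zr _] qn].
    exists b => //; rewrite in_setU1 (disjointFl disj bC') orbF eq_sym.
    by apply: (adj_neq zb).
  exists r => //; rewrite in_setU1 negb_or eq_sym (adj_neq zr) /=.
  by have := qn r; rewrite !inE eqxx orbT negb_or => /(_ isT)/andP[].
have wC : w \in C by rewrite defC mem_head.
have sC : s \in C by rewrite defC !inE eqxx !orbT.
apply: (attachment_junction p_inj v_inj cr defC zC _ _ _ zr).
- by rewrite ltn_neqAle (lim z (in_setT z)).1 andbT eq_sym (inj_neq p_inj) // zneq.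
- by rewrite ltn_neqAle (lim z (in_setT z)).2 andbT eq_sym (inj_neq v_inj) // zneq.
- by move=> t tC; apply: outside_above.
- by exists c; rewrite // adjC.
- exact: outside_nadj.
exact: no_other_core.
Qed.

(** The two other points of a core are adjacent to W or to S, so they belong to
    [C] or are equal to [z]. *)
Lemma side_core_uniq x1 y1 : core p v w x1 y1 s -> [set w; x1; y1; s] = C.
Proof.
move=> cr1; have [_ wy xs] := core_adj cr1.
have wC : w \in C by rewrite defC mem_head.
have sC : s \in C by rewrite defC !inE eqxx !orbT.
have sub : {subset [:: w; x1; y1; s] <= z |: C}.
  have near c t : c \in C -> adj p v c t -> t \in z |: C.
    by move=> cC; apply: contraTT; apply: outside_nadj.
  move=> t; rewrite !inE -(in_setU1 t z) => /or4P[] /eqP->; rewrite ?in_setU1 ?wC ?sC ?orbT //.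
    by rewrite -in_setU1; apply: (near s); rewrite // adjC.
  by rewrite -in_setU1; apply: (near w).
have zn := no_other_core sub cr1.
have cardC : #|C| = 4.
  by rewrite (eq_card defC); apply/card_uniqP; apply: core_uniq cr.
have defL : [set w; x1; y1; s] =i [:: w; x1; y1; s] by move=> t; rewrite !inE -!orbA.
apply/eqP; rewrite eqEcard cardC (eq_card defL) (card_uniqP (core_uniq cr1)) leqnn andbT.
apply/subsetP => t; rewrite defL => tL; have := sub t tL.
by rewrite in_setU1; case: eqP => // tz; rewrite tz (negbTE zn) in tL.
Qed.

Lemma cov_adj_adj D t u : cov_adj p v D t u -> adj p v t u.
Proof. by rewrite /cov_adj /covers /adj => /orP[] /and4P[_ _ -> _]; rewrite ?orbT. Qed.

Lemma side_out cyc a t u : junction p v C z cyc a -> t \in C -> u \notin C ->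
  cov_adj p v setT t u = (t == a) && (u == z).
Proof.
move=> [_ _ _ zt] tC uC; have [->|uz] := eqVneq u z; first by rewrite zt // andbT.
rewrite andbF; apply: contraNF (outside_nadj tC _); first exact: cov_adj_adj.
by rewrite in_setU1 negb_or uz.
Qed.

(** A point separating two path points would complete a triangle of inversions with
    them; a geodesic has no triangle, and an end core touches only one path point. *)
Lemma cov_adj_path t u : t \in z :: q -> u \in z :: q ->
  cov_adj p v setT t u = (index u (z :: q) == (index t (z :: q)).+1) ||
                      (index t (z :: q) == (index u (z :: q)).+1).
Proof.
move=> tq uq; have [_ step headq lastq _] := geo; rewrite -step //.
have nobetween t1 u1 : t1 \in z :: q -> u1 \in z :: q -> nw p v t1 u1 ->
    [exists j in setT, nw p v t1 j && nw p v j u1] = false.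
  move=> t1q u1q nw1; apply/negbTE/existsP => -[j /and3P[_ tj ju]].
  have atj : adj p v t1 j by rewrite /adj tj.
  have aju : adj p v j u1 by rewrite /adj ju.
  have atu : adj p v t1 u1 by rewrite /adj nw1.
  have := step _ _ t1q u1q; rewrite atu => /esym.
  case/or3P: (full j) => [jC|jq|jC'].
  - rewrite (headq _ _ jC u1q) // (headq _ _ jC t1q) //.
    by rewrite adjC.
  - have := step _ _ t1q jq; have := step _ _ jq u1q; rewrite atj aju => /esym + /esym.
    by move: (index t1 _) (index u1 _) (index j _); clear; lia.
  have ajt : adj p v j t1 by rewrite adjC.
  have H := etrans (lastq _ _ jC' u1q aju) (esym (lastq _ _ jC' t1q ajt)).
  by move: (index t1 _) (index u1 _) H; clear; lia.
rewrite /cov_adj /covers !in_setT /= /adj.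
by congr (_ || _); case: (boolP (nw p v _ _)) => //= H; rewrite nobetween.
Qed.

End OneSide.

(** On a duplicate-free path the edges are read off the indices, which is how a
    [geodesic] describes adjacency. *)
Lemma path_edge_index (T : eqType) (r : seq T) t u : uniq r ->
  path_edge r t u = [&& t \in r, u \in r & (index u r == (index t r).+1) ||
                                          (index t r == (index u r).+1)].
Proof.
move=> Ur.
have infE t1 u1 : infix [:: t1; u1] r = [&& t1 \in r, u1 \in r & index u1 r == (index t1 r).+1].
  apply/infixP/idP => [[r1 [r2 defr]]|/and3P[tr ur /eqP idx]].
    move: Ur; rewrite {}defr !mem_cat !inE !eqxx ?orbT /= cat_uniq /= => /and3P[_].
    rewrite !inE !negb_or => /and3P[tn un _] /andP[/andP[tu _] _].
    by rewrite !index_cat (negbTE tn) (negbTE un) /= !eqxx (negbTE tu) addn0 addn1.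
  exists (take (index t1 r) r), (drop (index u1 r).+1 r).
  rewrite -{1}(cat_take_drop (index t1 r) r) (drop_nth t1) ?index_mem // nth_index //.
  by rewrite -idx (drop_nth t1) ?index_mem // nth_index.
rewrite /path_edge !infE; case: (t \in r); case: (u \in r) => //=.
Qed.

(** * Assembling the dumbbell *)

Lemma eq_geodesic (T : finType) (e e' : rel T) (A B : {set T}) q :
  e =2 e' -> geodesic e A B q -> geodesic e' A B q.
Proof.
move=> ee' [H1 H2 H3 H4 [c [b [cA bB qP]]]]; split=> //.
- by move=> t u tq uq; rewrite -ee' H2.
- by move=> t u tA uq; rewrite -ee'; apply: H3.
- by move=> t u tA uq; rewrite -ee'; apply: H4.
by exists c, b; rewrite -(eq_path ee').
Qed.

Lemma reversed_sym (T : finType) (f f' : T -> nat) : reversed f f' -> reversed f' f.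
Proof. by move=> rev_f x y; rewrite rev_f. Qed.

Section Assemble.
Variables (T : finType) (p v p' v' : T -> nat).
Implicit Types (U A : {set T}).
Hypotheses (p_inj : injective p) (v_inj : injective v).
Hypotheses (rev_p : reversed p p') (rev_v : reversed v v').

Lemma proper_sets_tight_sym : proper_sets_tight p v p' v' -> proper_sets_tight p' v' p v.
Proof.
move=> min U w x y s e x' y' n neU cr cr' nsplit.
rewrite !(adj_rev rev_p rev_v) [adj p v w e]adjC [adj p v s n]adjC.
have nsplit' A : ~ splits p v U A by move/(splits_rev rev_p rev_v); apply: nsplit.
by have [] := min U _ _ _ _ _ _ _ _ neU cr' cr nsplit'.
Qed.

Lemma cycle_cov_adj C cyc t u : (forall t u, cycle_edge cyc t u = cov_adj p v C t u) ->
  cycle_edge cyc t u -> (t \in C) && (u \in C).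
Proof. by move=> -> /orP[]; rewrite /covers => /and4P[-> ->]. Qed.

(** The two junctions give the ends of the dumbbell and the geodesic its bar; what is
    left is to match the path edges, indexed along [a :: rcons Q a'], with the
    covers found on each part. *)
Lemma dumbbell_of_geodesic (C C' : {set T}) w x y s e x' y' n Q :
  core_in p v setT w x y s -> C =i [:: w; x; y; s] ->
  core_in p' v' setT e x' y' n -> C' =i [:: e; x'; y'; n] ->
  [disjoint C & C'] -> {in C & C', forall c c', ~~ adj p v c c'} ->
  geodesic (adj p v) C C' Q -> Q != [::] ->
  (forall t, [|| t \in C, t \in Q | t \in C']) ->
  proper_sets_tight p v p' v' ->
  [/\ forall x1 y1, core p v w x1 y1 s -> [set w; x1; y1; s] = C,
      forall x1 y1, core p' v' e x1 y1 n -> [set e; x1; y1; n] = C' &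
      exists cyc cyc' a a',
      [/\ [/\ size cyc = 4, uniq cyc, cyc =i C &
              forall t u, cycle_edge cyc t u = cov_adj p v C t u],
          [/\ size cyc' = 4, uniq cyc', cyc' =i C' &
              forall t u, cycle_edge cyc' t u = cov_adj p v C' t u] &
          dumbbell (cov_adj p v setT) cyc cyc' a a' Q]].
Proof.
move=> core_C defC core_C' defC' disj nadj geo Q0 full min.
have adjE := adj_rev rev_p rev_v.
have geo' : geodesic (adj p' v') C' C (rev Q).
  apply: (eq_geodesic (e := adj p v)); first by move=> t u; rewrite adjE.
  by apply: geodesic_rev geo => t u; rewrite adjC.
have [p'_inj v'_inj] := (reversed_inj p_inj rev_p, reversed_inj v_inj rev_v).
have [rev_p' rev_v'] := (reversed_sym rev_p, reversed_sym rev_v).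
have disj' : [disjoint C' & C] by rewrite disjoint_sym.
have nadj' : {in C' & C, forall c c', ~~ adj p' v' c c'}.
  by move=> c c' cC c'C; rewrite adjE adjC nadj.
have full' t : [|| t \in C', t \in rev Q | t \in C].
  by rewrite mem_rev; case/or3P: (full t) => ->; rewrite ?orbT.
have min' := proper_sets_tight_sym min.
case defQ : Q => [|z q]; first by rewrite defQ in Q0.
case defQ' : (rev Q) => [|z' q'].
  by move/(congr1 size): defQ'; rewrite size_rev defQ.
have geo1 := geo; have full1 := full; rewrite defQ in geo1 full1.
rewrite defQ' in geo' full'; rewrite -defQ.
split.
- exact: (side_core_uniq p_inj v_inj rev_p rev_v core_C defC core_C' defC' disj nadj geo1 full1 min).
- exact: (side_core_uniq p'_inj v'_inj rev_p' rev_v' core_C' defC' core_C defC disj' nadj' geo' full' min').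
have [cyc [a junc]] := side_junction p_inj v_inj rev_p rev_v core_C defC core_C' defC' disj nadj geo1 full1 min.
have [cyc' [a' junc']] := side_junction p'_inj v'_inj rev_p' rev_v' core_C' defC' core_C defC disj' nadj' geo' full' min'.
have out t u : t \in C -> u \notin C -> cov_adj p v setT t u = (t == a) && (u == z).
  by move=> tC uC; apply: (side_out nadj geo1 full1 junc tC uC).
have out' t u : t \in C' -> u \notin C' -> cov_adj p v setT t u = (t == a') && (u == z').
  by move=> tC uC; rewrite -(cov_adj_rev rev_p rev_v); apply: (side_out nadj' geo' full' junc' tC uC).
exists cyc, cyc', a, a'.
have [[sz Ucyc memcyc aC] cycE inC _] := junc.
have [[sz' Ucyc' memcyc' aC'] cycE' inC' _] := junc'.
have cycE'' t u : cycle_edge cyc' t u = cov_adj p v C' t u.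
  by rewrite cycE' (cov_adj_rev rev_p rev_v).
split=> //.
have [[UQ Qn] _ _ _ _] := geo.
have QC t : t \in Q -> t \notin C /\ t \notin C'.
  by move=> /Qn; rewrite inE negb_or => /andP[].
have aQ : a \notin Q by apply/negP => /QC[]; rewrite aC.
have aQ' : a' \notin Q by apply/negP => /QC[_]; rewrite aC'.
have CC' t : t \in C -> t \notin C' by move=> tC; rewrite (disjointFr disj tC).
have C'C t : t \in C' -> t \notin C by move=> tC; rewrite (disjointFl disj tC).
have aa' : a != a' by apply: contraTneq aC => ->; apply: C'C.
have [r defr] : exists r, r = a :: rcons Q a' by eexists.
have Ur : uniq r.
  by rewrite defr /= mem_rcons rcons_uniq inE negb_or aa' aQ aQ'.
have z'Q : z' \in Q by rewrite -mem_rev defQ' mem_head.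
have idx_z' : (index z' Q).+1 = size Q.
  have := index_rev UQ z'Q; rewrite defQ' /= eqxx; have := z'Q; rewrite -index_mem.
  by move: (index z' Q) (size Q); clear; lia.
have memr t : (t \in r) = [|| t == a, t \in Q | t == a'].
  by rewrite defr inE mem_rcons inE [(t == a') || _]orbC.
have idx_a : index a r = 0 by rewrite defr /= eqxx.
have idx_Q t : t \in Q -> index t r = (index t Q).+1.
  move=> tQ; rewrite defr /= -cats1 index_cat tQ; case: eqP => // at_.
  by rewrite at_ tQ in aQ.
have idx_a' : index a' r = (size Q).+1.
  by rewrite defr /= -cats1 index_cat (negbTE aQ') (negbTE aa') /= eqxx addn0.
have idx_z : index z Q = 0 by rewrite defQ /= eqxx.
have zQ : z \in Q by rewrite defQ mem_head.
have Q_gt0 : 0 < size Q by rewrite defQ.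
have edgeC t u : t \in C -> u \notin C -> path_edge r t u = (t == a) && (u == z).
  move=> tC uC; rewrite path_edge_index // !memr.
  have tQ : t \notin Q by apply/negP => /QC[]; rewrite tC.
  have ta' : t != a' by apply: contraTneq tC => ->; apply: C'C.
  have ua : u != a by apply: contraNneq uC => ->.
  rewrite (negbTE tQ) (negbTE ta') (negbTE ua) !orbF /=.
  have [->|//] := eqVneq t a; rewrite idx_a /= orbF.
  have [uQ|uQ] := boolP (u \in Q).
    rewrite idx_Q //= eqSS; apply/eqP/eqP => [H|->//].
    by apply: (index_inj u uQ zQ); rewrite H idx_z.
  have [->|_] := eqVneq u a'; last by apply/esym/negbTE; apply: contraNneq uQ => ->.
  rewrite idx_a' /= eqSS; apply/eqP/eqP => [H|H]; first by rewrite H in Q_gt0.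
  by rewrite H zQ in aQ'.
have edgeC' t u : t \in C' -> u \notin C' -> path_edge r t u = (t == a') && (u == z').
  move=> tC uC; rewrite path_edge_index // !memr.
  have tQ : t \notin Q by apply/negP => /QC[]; rewrite tC.
  have ta : t != a by apply: contraTneq tC => ->; apply: CC'.
  have ua' : u != a' by apply: contraNneq uC => ->.
  rewrite (negbTE tQ) (negbTE ta) (negbTE ua') !orbF /=.
  have [->|//] := eqVneq t a'; rewrite idx_a'.
  have [uQ|uQ] := boolP (u \in Q).
    rewrite orbT idx_Q //= !eqSS -idx_z' eqSS.
    have := uQ; rewrite -index_mem -idx_z' => le_u.
    rewrite [_ == _.+2]ltn_eqF ?orFb; last by move: le_u; clear; lia.
    by apply/eqP/eqP => [H|->//]; apply: (index_inj u uQ z'Q (esym H)).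
  have [->|_] := eqVneq u a; last by apply/esym/negbTE; apply: contraNneq uQ => ->.
  rewrite idx_a /= eqSS; apply/eqP/eqP => [H|H]; first by rewrite H in Q_gt0.
  by rewrite H z'Q in aQ.
have cyc0 t u : (t \notin C) || (u \notin C) -> cycle_edge cyc t u = false.
  by move=> tu; apply/negbTE; apply: contraTN tu => /(cycle_cov_adj cycE); rewrite -negb_and negbK.
have cyc0' t u : (t \notin C') || (u \notin C') -> cycle_edge cyc' t u = false.
  by move=> tu; apply/negbTE; apply: contraTN tu => /(cycle_cov_adj cycE''); rewrite -negb_and negbK.
have pathC t u : path_edge r t u = path_edge r u t by rewrite /path_edge orbC.
have selfpath t : path_edge r t t = false.
  by rewrite path_edge_index // eqn_leq ltnn andbF !andbF.
have cycC t u : cycle_edge cyc t u = cycle_edge cyc u t by rewrite !cycE cov_adjC.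
have cycC' t u : cycle_edge cyc' t u = cycle_edge cyc' u t by rewrite !cycE'' cov_adjC.
(* up to exchanging t and u, a point of an end core comes first *)
have main t u : (t \in C) || (u \notin C) && ((t \in C') || (u \notin C')) ->
    cov_adj p v setT t u = [|| cycle_edge cyc t u, cycle_edge cyc' t u | path_edge r t u].
  case/orP => [tC|/andP[uC /orP[tC'|uC']]].
  - have -> : cycle_edge cyc' t u = false by rewrite cyc0' // (CC' t tC).
    have [uC|uC] := boolP (u \in C); last by rewrite cyc0 ?uC ?orbT // edgeC // out.
    rewrite inC // cycE; case E: (path_edge r t u); rewrite ?orbF //.
    move: (E); rewrite path_edge_index // !memr => /and3P[+ + _].
    have nQ y1 : y1 \in C -> (y1 \in Q) || (y1 == a') = false.
      move=> y1C; apply/negbTE; rewrite negb_or; apply/andP; split.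
        by apply/negP => /QC[]; rewrite y1C.
      by apply: contraTneq y1C => ->; apply: C'C.
    rewrite !nQ // !orbF => /eqP ta /eqP ua.
    by rewrite ta ua selfpath in E.
  - rewrite [cycle_edge cyc t u]cyc0 ?uC ?orbT //.
    have [uC'|uC'] := boolP (u \in C'); last by rewrite cyc0' ?uC' ?orbT // edgeC' // out'.
    rewrite -(cov_adj_rev rev_p rev_v) inC' // cycE'; case E: (path_edge r t u); rewrite ?orbF //.
    move: (E); rewrite path_edge_index // !memr => /and3P[+ + _].
    have nQ y1 : y1 \in C' -> [|| y1 == a, y1 \in Q | y1 == a'] = (y1 == a').
      move=> y1C; have /negbTE-> : y1 != a by apply: contraTneq y1C => ->; apply: CC'.
      by have /negbTE-> : y1 \notin Q by apply/negP => /QC[_]; rewrite y1C.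
    rewrite !nQ // => /eqP ta /eqP ua.
    by rewrite ta ua selfpath in E.
  - have [tC|tC] := boolP (t \in C).
      by rewrite cyc0 ?uC ?orbT // cyc0' ?uC' ?orbT // edgeC // out.
    have [tC'|tC'] := boolP (t \in C').
      by rewrite cyc0 ?uC ?orbT // cyc0' ?uC' ?orbT // edgeC' // out'.
    rewrite cyc0 ?uC ?orbT // cyc0' ?uC' ?orbT //=.
    have inQ y1 : y1 \notin C -> y1 \notin C' -> y1 \in Q.
      by move=> /negbTE y1C /negbTE y1C'; have := full y1; rewrite y1C y1C' orbF.
    have tQ := inQ t tC tC'; have uQ := inQ u uC uC'.
    rewrite path_edge_index // !memr tQ uQ !orbT /= !idx_Q // !eqSS.
    by rewrite defQ; apply: (cov_adj_path geo1 full1); rewrite -defQ.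
split.
- by rewrite sz sz'.
- split; last by move=> t; rewrite !mem_cat memcyc memcyc'; apply: full.
  rewrite cat_uniq Ucyc cat_uniq Ucyc' UQ /= andbT; apply/andP; split; apply/hasPn => t.
    rewrite mem_cat memcyc' => /orP[/QC[+ _]|/C'C]; by rewrite memcyc.
  by rewrite memcyc' => tC'; apply/negP => /QC[_]; rewrite tC'.
- by rewrite memcyc memcyc'.
move=> t u; rewrite -defr.
have [ok|] := boolP ((t \in C) || (u \notin C) && ((t \in C') || (u \notin C'))).
  exact: main.
move=> nok; rewrite cov_adjC cycC cycC' pathC; apply: main.
move: nok (CC' u); case: (t \in C); case: (u \in C); case: (t \in C'); case: (u \in C') => //=.
Qed.
End Assemble.

(** * Patterns of a permutation as permutations *)

Definition posn n (i : 'I_n) : nat := i.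
Definition valn n (s : 'S_n) (i : 'I_n) : nat := s i.

Lemma posn_inj n : injective (@posn n). Proof. exact: val_inj. Qed.
Lemma valn_inj n (s : 'S_n) : injective (valn s).
Proof. by move=> i j /val_inj/perm_inj. Qed.

Definition ltord n (i j : 'I_n) := i < j.

Lemma ltord_trans n : transitive (@ltord n).
Proof. by move=> j i k; apply: ltn_trans. Qed.

Lemma sorted_enum n (U : {set 'I_n}) : sorted (@ltord n) (enum U).
Proof.
rewrite /enum_mem; apply: sorted_filter; first exact: ltord_trans.
by rewrite -enumT; have := iota_ltn_sorted 0 n; rewrite -val_enum_ord sorted_map.
Qed.

Lemma enum_val_mono n (U : {set 'I_n}) (i j : 'I_#|U|) :
  (enum_val i < enum_val j) = (i < j).
Proof.
have mono (k l : 'I_#|U|) : k < l -> enum_val k < enum_val l.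
  have x0 := enum_val k; move=> ltkl; rewrite !(enum_val_nth x0).
  by apply: (sorted_ltn_nth (@ltord_trans n) _ (sorted_enum U)); rewrite // inE -cardE.
have [/mono//|ji|/val_inj->] := ltngtP i j; last by rewrite ltnn.
by rewrite ltnNge ltnW // mono.
Qed.

Lemma map_enum_val (T : finType) (U : {set T}) :
  [seq enum_val i | i <- enum 'I_#|U|] = enum U.
Proof.
rewrite -[RHS](map_tnth_enum (enum_tuple U)); apply: eq_map => i.
have x0 := enum_val i.
by rewrite (enum_val_nth x0) (tnth_nth x0).
Qed.

Lemma count_enum n (s : 'S_n) (U : {set 'I_n}) m :
  count (leq^~ m) [seq val (s j) | j <- enum U] = #|[set j in U | s j <= m]|.
Proof.
rewrite count_map -size_filter cardE /enum_mem -filter_predI; congr size.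
by apply: eq_filter => j; rewrite /= !inE andbC.
Qed.

(** The value at [i] is the rank of the [i]-th point of [U] among the values taken
    on [U]. *)
Lemma pattern_perm n (s : 'S_n) (U : {set 'I_n}) : exists t : 'S_#|U|,
  oneline t = pattern_on s U /\
  forall i j, (t i < t j) = (s (enum_val i) < s (enum_val j)).
Proof.
pose below x := [set j in U | s j < s x].
have lt_below i : #|below (@enum_val _ (mem U) i)| < #|U|.
  apply: proper_card; apply/properP; split; first by apply/subsetP => j; rewrite !inE => /andP[].
  by exists (enum_val i); rewrite ?enum_valP // !inE ltnn andbF.
pose f i := Ordinal (lt_below i).
have mono i j : s (enum_val i) < s (enum_val j) -> f i < f j.
  move=> lt; apply: proper_card; apply/properP; split.
    by apply/subsetP => k; rewrite !inE => /andP[-> /ltn_trans]; apply.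
  by exists (enum_val i); rewrite !inE ?enum_valP ?ltnn ?lt ?andbF.
have ltE i j : (f i < f j) = (s (enum_val i) < s (enum_val j)).
  have [/mono//|ji|/val_inj/perm_inj/enum_val_inj->] := ltngtP (s (enum_val i)) (s (enum_val j)).
    by rewrite ltnNge ltnW // mono.
  by rewrite ltnn.
have f_inj : injective f.
  move=> i j eq_f; apply: enum_val_inj; apply: (@perm_inj _ s); apply: val_inj.
  by have := ltE i j; have := ltE j i; rewrite eq_f ltnn /=; case: ltngtP.
exists (perm f_inj); split; last by move=> i j; rewrite !permE.
rewrite /oneline /pattern_on /std (eq_map (@count_enum n s U)).
rewrite -(map_enum_val U) -!map_comp; apply: eq_map => i; rewrite /= permE /=.
rewrite [in RHS](_ : [set j in U | _] = enum_val i |: below (enum_val i)).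
  by rewrite cardsU1 !inE ltnn andbF.
apply/setP=> j; rewrite !inE leq_eqVlt; have [->|ji] := eqVneq j (enum_val i).
  by rewrite eqxx enum_valP.
rewrite (_ : (_ == _ :> nat) = false) //; apply: contraNF ji => /eqP H.
by apply/eqP; apply: (@perm_inj _ s); apply: val_inj.
Qed.

Lemma size_oneline n (s : 'S_n) : size (oneline s) = n.
Proof. by rewrite size_map size_enum_ord. Qed.

Lemma nth_oneline n (s : 'S_n) (i : 'I_n) : nth 0 (oneline s) i = (s i).+1.
Proof. by rewrite (nth_map i) ?size_enum_ord // nth_ord_enum. Qed.

(** The letters of a permutation are their own ranks: a permutation is the pattern
    of its full set of points. *)
Lemma oneline_count n (s : 'S_n) (i : 'I_n) : (s i).+1 = #|[set j | s j <= s i]|.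
Proof.
have lt := ltn_ord (s i).
have -> : [set j | s j <= s i] = s @^-1: (widen_ord lt @: setT).
  apply/setP => j; rewrite !inE; apply/idP/imsetP => [le|[k _ ->]].
    by exists (inord (s j)); rewrite ?inE //; apply: val_inj; rewrite /= inordK.
  by rewrite /= -ltnS.
rewrite on_card_preimset; last first.
  by exists (s^-1)%g => k _; rewrite ?permK ?permKV.
by rewrite card_imset ?cardsT ?card_ord //; by move=> j k /(congr1 val) /= H; apply: val_inj.
Qed.

Lemma enum_setT_ord n : enum [set: 'I_n] = enum 'I_n.
Proof. by rewrite /enum_mem; apply: eq_filter => i; rewrite !inE. Qed.

Lemma oneline_pattern n (s : 'S_n) : oneline s = pattern_on s setT.
Proof.
rewrite /pattern_on /std (eq_map (@count_enum n s setT)) -map_comp.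
rewrite enum_setT_ord.
apply: eq_map => i; rewrite oneline_count /=; apply: eq_card => j.
by rewrite !inE.
Qed.

(** * Decomposability and splittings *)

Lemma oneline_range n (s : 'S_n) i : i < n -> 0 < nth 0 (oneline s) i <= n.
Proof. by move=> lti; rewrite (nth_oneline s (Ordinal lti)) /= ltn_ord. Qed.

Lemma size_dsum u v : size (dsum u v) = size u + size v.
Proof. by rewrite size_cat size_map. Qed.

Lemma std_dsum u v : (forall x y, x \in u -> y \in v -> x < y) ->
  std (u ++ v) = dsum (std u) (std v).
Proof.
move=> ltuv; rewrite /std /dsum map_cat size_map -map_comp; congr (_ ++ _).
  apply/eq_in_map => x xu; rewrite count_cat [X in _ + X](_ : _ = 0) ?addn0 //.
  rewrite -(count_pred0 v); apply: eq_in_count => y yv /=.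
  by rewrite leqNgt ltuv.
apply/eq_in_map => y yv; rewrite count_cat /=; congr (_ + _).
rewrite -(count_predT u); apply: eq_in_count => x xu /=.
by rewrite ltnW // ltuv.
Qed.

Lemma enum_split n (A U : {set 'I_n}) : A \subset U ->
  {in A & U :\: A, forall i j : 'I_n, i < j} -> enum U = enum A ++ enum (U :\: A).
Proof.
move=> sAU lt; apply: (irr_sorted_eq (@ltord_trans n)); first by move=> i; apply: ltnn.
- exact: sorted_enum.
- rewrite (sorted_pairwise (@ltord_trans n)) pairwise_cat.
  rewrite -!(sorted_pairwise (@ltord_trans n)) !sorted_enum !andbT.
  by apply/allrelP => i j; rewrite !mem_enum; apply: lt.
move=> i; rewrite mem_cat !mem_enum !inE.
by case: (boolP (i \in A)) => //= /(subsetP sAU).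
Qed.

(** The summands are the patterns on the two parts of the splitting. *)
Lemma splits_decomposable n (s : 'S_n) A :
  splits (@posn n) (valn s) setT A -> decomposable s.
Proof.
case=> _ [i0 i0A] [j0 j0A] below; set B := setT :\: A in j0A below *.
have [t [tE _]] := pattern_perm s A; have [u [uE _]] := pattern_perm s B.
exists #|A|, #|B|, t, u; split; try by apply/card_gt0P; eexists; eassumption.
rewrite oneline_pattern tE uE /pattern_on (enum_split (subsetT A)); last first.
  by move=> i j iA jB; have /andP[] := below i j iA jB.
rewrite map_cat; apply: std_dsum => _ _ /mapP[i iA ->] /mapP[j jB ->].
by rewrite !mem_enum in iA jB; have /andP[] := below i j iA jB.
Qed.

Section Pattern.
Variables (n : nat) (s : 'S_n) (U : {set 'I_n}) (t : 'S_#|U|).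
Hypothesis ltE : forall i j, (t i < t j) = (s (enum_val i) < s (enum_val j)).

Lemma rankP x : x \in U -> exists i : 'I_#|U|, x = enum_val i.
Proof. by move=> xU; exists (enum_rank_in xU x); rewrite enum_rankK_in. Qed.

Lemma pattern_splits : decomposable t ->
  exists A, splits (@posn n) (valn s) U A.
Proof.
case=> a [b [t1 [u1 [a_gt0 b_gt0 defT]]]].
have szU : #|U| = a + b.
  by rewrite -(size_oneline t) defT size_dsum !size_oneline.
have lo (i : 'I_#|U|) : i < a -> t i < a.
  move=> lti; have := nth_oneline t i; rewrite defT nth_cat size_oneline lti => <-.
  by have /andP[] := oneline_range t1 lti.
have hi (i : 'I_#|U|) : a <= i -> a <= t i.
  move=> lei; have := nth_oneline t i; rewrite defT nth_cat size_oneline ltnNge lei /=.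
  have ltib : i - a < b by rewrite ltn_subLR // -szU.
  rewrite (nth_map 0) ?size_oneline // -ltnS => <-.
  have /andP[] := oneline_range u1 ltib; case: (nth _ _ _) => // k _ _.
  by rewrite addnS ltnS leq_addr.
have lt0 : 0 < #|U| by rewrite szU addn_gt0 a_gt0.
have lta : a < #|U| by rewrite szU -addn1 leq_add2l.
exists [set enum_val i | i : 'I_#|U| & i < a]; split.
- by apply/subsetP => _ /imsetP[i _ ->]; apply: enum_valP.
- by exists (enum_val (Ordinal lt0)); apply/imset_f; rewrite inE.
- exists (enum_val (Ordinal lta)); rewrite inE enum_valP andbT.
  by apply/imsetP => -[i]; rewrite inE => lti /enum_val_inj/(congr1 val)/= H; rewrite -H ltnn in lti.
move=> _ j /imsetP[i lti ->]; rewrite inE in lti; rewrite inE => /andP[jA /rankP[k defj]].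
have lek : a <= k.
  by rewrite leqNgt; apply: contra jA => ltk; rewrite defj imset_f ?inE.
rewrite /sw /posn /valn defj enum_val_mono -ltE (leq_trans lti lek) /=.
by rewrite (leq_trans (lo i lti) (hi k lek)).
Qed.

End Pattern.

(** * Good corners and critical permutations *)

(** The ascents that spoil the windows of W and S: in a 3412 they are S with the last point
    and W with the point after it, in a 4231 the middle pair serves both corners. *)
Lemma core_ascents (T : finType) (p v : T -> nat) w x y s : core p v w x y s ->
  (exists i j, [/\ i \in [:: w; x; y; s], j \in [:: w; x; y; s],
                   nw p v w i, nw p v w j & sw p v i j]) /\
  (exists i j, [/\ i \in [:: w; x; y; s], j \in [:: w; x; y; s],
                   nw p v i s, nw p v j s & sw p v i j]).
Proof.
rewrite /core => /and5P[wx xy xs sy /and3P[yw sx /orP[]/andP[]]] => [sy'|ys'] xyw;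
  split.
- by exists s, y; rewrite !inE !eqxx !orbT /nw /sw; split=> //; lia.
- by exists w, x; rewrite !inE !eqxx !orbT /nw /sw; split=> //; lia.
- by exists x, y; rewrite !inE !eqxx !orbT /nw /sw; split=> //; lia.
- by exists x, y; rewrite !inE !eqxx !orbT /nw /sw; split=> //; lia.
Qed.

(** Only the order of these numbers matters; as [i < n], the subtraction never
    truncates. *)
Definition rposn n (i : 'I_n) : nat := n - i.
Definition rvaln n (s : 'S_n) (i : 'I_n) : nat := n - s i.

Lemma rev_ord_sub n (i j : 'I_n) : (n - i < n - j) = (j < i).
Proof. by have := ltn_ord i; have := ltn_ord j; lia. Qed.

Lemma rev_posn n : reversed (@posn n) (@rposn n).
Proof. by move=> i j; apply: rev_ord_sub. Qed.

Lemma rev_valn n (s : 'S_n) : reversed (valn s) (rvaln s).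
Proof. by move=> i j; apply: rev_ord_sub. Qed.

Section Corners.
Variables (n : nat) (s : 'S_n) (U : {set 'I_n}) (t : 'S_#|U|).
Hypothesis ltE : forall i j, (t i < t j) = (s (enum_val i) < s (enum_val j)).
Let p := @posn n.
Let v := valn s.
Let p' := @rposn n.
Let v' := rvaln s.

Let nwE i j : nw p v (enum_val i) (enum_val j) = (i < j) && (t j < t i).
Proof. by rewrite /nw /p /posn /v /valn enum_val_mono ltE. Qed.
Let swE i j : sw p v (enum_val i) (enum_val j) = (i < j) && (t i < t j).
Proof. by rewrite /sw /p /posn /v /valn enum_val_mono ltE. Qed.

Lemma window_down c d i j : c = W_corner \/ c = N_corner -> good_corner t c d ->
  i \in U -> j \in U -> nw p v (enum_val d) i -> nw p v (enum_val d) j ->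
  sw p v i j -> False.
Proof.
move=> cE [_ good] /rankP[i0 ->] /rankP[j0 ->]; rewrite !nwE swE => di dj /andP[ij tij].
have iw : i0 \in window t c d by case: cE => ->; rewrite inE.
have jw : j0 \in window t c d by case: cE => ->; rewrite inE.
by have := good i0 j0 iw jw ij; rewrite ltnNge ltnW.
Qed.

Lemma window_up c d i j : c = S_corner \/ c = E_corner -> good_corner t c d ->
  i \in U -> j \in U -> nw p v i (enum_val d) -> nw p v j (enum_val d) ->
  sw p v i j -> False.
Proof.
move=> cE [_ good] /rankP[i0 ->] /rankP[j0 ->]; rewrite !nwE swE => di dj /andP[ij tij].
have iw : i0 \in window t c d by case: cE => ->; rewrite inE.
have jw : j0 \in window t c d by case: cE => ->; rewrite inE.
by have := good i0 j0 iw jw ij; rewrite ltnNge ltnW.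
Qed.

Lemma corner_pos c (d : 'I_#|U|) z : good_corner t c d -> z \in U -> z = enum_val d \/
  match c with
  | W_corner => p (enum_val d) < p z
  | N_corner => v z < v (enum_val d)
  | S_corner => v (enum_val d) < v z
  | E_corner => p z < p (enum_val d)
  end.
Proof.
case=> corner_d _ /rankP[k ->]; have [->|kd] := eqVneq k d; [by left | right].
have tkd : t k != t d by rewrite (inj_eq perm_inj).
have [k_lt tk_lt] := (ltn_ord k, ltn_ord (t k)).
case: c corner_d => /= /eqP H; rewrite /p /posn /v /valn ?enum_val_mono -?ltE.
- by rewrite ltn_neqAle H leq0n andbT -H eq_sym.
- by rewrite ltn_neqAle tkd -ltnS H.
- by rewrite ltn_neqAle eq_sym tkd H.
by rewrite ltn_neqAle kd -ltnS H.
Qed.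

Lemma core_corners w x y s0 e x' y' n0 c d :
  core_in p v U w x y s0 -> core_in p' v' U e x' y' n0 -> ~ good_corner t c d.
Proof.
move=> [cr sub lim] [cr' sub' lim'] good.
have [rp rv] := (@rev_posn n, rev_valn s).
have [[wi [wj [wiL wjL wwi wwj wij]]] [si [sj [siL sjL ssi ssj sij]]]] := core_ascents cr.
have [[ei [ej [eiL ejL eei eej eij]]] [ni [nj [niL njL nni nnj nij]]]] := core_ascents cr'.
rewrite !(nw_rev rp rv) !(sw_rev rp rv) in eei eej eij nni nnj nij.
have dU := @enum_valP _ (mem U) d.
have [wd sd] := lim _ dU; have [ed nd] := lim' _ dU.
have {}ed : p (enum_val d) <= p e by rewrite leqNgt -rp -leqNgt.
have {}nd : v (enum_val d) <= v n0 by rewrite leqNgt -rv -leqNgt.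
have [wU s0U eU n0U] : [/\ w \in U, s0 \in U, e \in U & n0 \in U].
  by split; [apply: sub | apply: sub | apply: sub' | apply: sub'];
    rewrite !inE eqxx ?orbT.
case: c good => good.
- case: (corner_pos good wU) => [E|]; last by rewrite ltnNge wd.
  by rewrite E in wwi wwj; apply: window_down good (sub _ wiL) (sub _ wjL) wwi wwj wij; left.
- case: (corner_pos good n0U) => [E|]; last by rewrite ltnNge nd.
  by rewrite E in nni nnj; apply: window_down good (sub' _ njL) (sub' _ niL) nnj nni nij; right.
- case: (corner_pos good s0U) => [E|]; last by rewrite ltnNge sd.
  by rewrite E in ssi ssj; apply: window_up good (sub _ siL) (sub _ sjL) ssi ssj sij; left.
case: (corner_pos good eU) => [E|]; last by rewrite ltnNge ed.
by rewrite E in eei eej; apply: window_up good (sub' _ ejL) (sub' _ eiL) eej eei eij; right.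
Qed.
End Corners.

(** Inverting the recursion.  The last rule is not productive for an indecomposable
    permutation, which is its own only summand; hence the induction. *)
Lemma pseudosmooth_tower m (t : 'S_m) : pseudosmooth t -> 1 < m ->
  ~ decomposable t -> (forall c d, ~ good_corner t c d) -> tower t.
Proof.
elim=> {m t} // [n s c d m t _ _ good _ _ _ _ _ nogood | n s _ IH n_gt1 indec nogood].
  by case: (nogood c d).
apply: (IH n s) => //; split=> //; first exact: ltnW.
exists 0, 0, 1%g, 1%g; rewrite /dsum !(size0nil (size_oneline (1%g : 'S_0))) /= cats0.
by rewrite (eq_map add0n) map_id.
Qed.

Lemma std_shift a u : std (map (addn a) u) = std u.
Proof.
rewrite /std -map_comp; apply: eq_map => x /=.
by rewrite count_map; apply: eq_count => y /=; rewrite leq_add2l.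
Qed.

Lemma std_oneline n (s : 'S_n) : std (oneline s) = oneline s.
Proof.
rewrite [in RHS]oneline_pattern /pattern_on -[in RHS](std_shift 1) -map_comp; congr std.
by rewrite enum_setT_ord.
Qed.

Lemma summand_contains n (s : 'S_n) m (t : 'S_m) :
  indecomposable_summand s t -> contains s t.
Proof.
case=> m_gt0 _ [a [b [u [v defS]]]].
have szs : n = a + (m + b).
  by rewrite -(size_oneline s) defS !size_dsum !size_oneline.
exists [set i : 'I_n | a <= i < a + m].
rewrite -std_oneline /pattern_on -[in LHS](std_shift 1) -[in RHS](std_shift a) -map_comp; congr std.
have -> : map (addn a) (oneline t) = take m (drop a (oneline s)).
  rewrite defS drop_size_cat ?size_oneline // -map_take.
  by rewrite take_size_cat ?size_oneline.
rewrite -(map_nth_iota 0) ?size_oneline ?szs ?addKn ?leq_addr //.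
have -> : iota a m = map val (enum [set i : 'I_n | a <= i < a + m]).
  apply: (irr_sorted_eq ltn_trans ltnn); first exact: iota_ltn_sorted.
    by rewrite sorted_map; apply: sorted_enum.
  move=> i; rewrite mem_iota; apply/idP/mapP => [iam|[j]]; last by rewrite mem_enum inE => ? ->.
  have lti : i < n by case/andP: iam => _ /leq_trans; apply; rewrite szs addnA leq_addr.
  by exists (Ordinal lti); rewrite ?mem_enum ?inE.
by rewrite -map_comp; apply: eq_map => i /=; rewrite nth_oneline.
Qed.

Lemma critical_bad n (s : 'S_n) : critical s ->
  [/\ 1 < n, ~ decomposable s, (forall c d, ~ good_corner s c d) & ~ tower s].
Proof.
case=> nps ps_sub.
have n_gt1 : 1 < n.
  by case: n s nps {ps_sub} => [|[|n]] s nps //; case: nps; constructor.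
have indec : ~ decomposable s.
  move=> dec; apply: nps; apply: ps_sum => m t summ.
  have := summ; case=> m_gt0 indec [a [b [u [v defS]]]].
  have szs : n = a + (m + b).
    by rewrite -(size_oneline s) defS !size_dsum !size_oneline.
  have [ltmn|lenm] := ltnP m n; first exact/ps_sub/summand_contains.
  have [a0 b0] : a = 0 /\ b = 0 by split; lia.
  case: indec; move: u v defS szs; rewrite a0 b0 => u v defS szs.
  have E : oneline s = oneline t.
    rewrite defS /dsum !(size0nil (size_oneline _)) /= cats0.
    by rewrite (eq_map add0n) map_id.
  by case: dec => a1 [b1 [t1 [u1 [a1_gt0 b1_gt0]]]]; rewrite E; exists a1, b1, t1, u1.
split=> //.
  move=> c d good; have [t [tE _]] := pattern_perm s [set~ d].
  apply: nps; apply: (ps_corner n_gt1 indec good tE); apply: ps_sub.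
    by rewrite cardsC1 card_ord ltn_predL ltnW.
  by exists [set~ d].
by move=> tw; apply: nps; apply: ps_tower.
Qed.

(** The pattern on a proper subset is pseudosmooth, and with a core at each end none
    of its corners is good, so only the tower rule can apply. *)
Lemma critical_proper n (s : 'S_n) (U : {set 'I_n}) w x y s0 e x' y' n0 :
  critical s -> U != setT ->
  core_in (@posn n) (valn s) U w x y s0 ->
  core_in (@rposn n) (rvaln s) U e x' y' n0 ->
  (forall A, ~ splits (@posn n) (valn s) U A) ->
  exists t : 'S_#|U|, tower t /\ 
    forall i j, (t i < t j) = (s (enum_val i) < s (enum_val j)).
Proof.
move=> [_ ps_sub] UT cr cr' nsplit; have [t [tE ltE]] := pattern_perm s U.
exists t; split=> //; apply: pseudosmooth_tower.
- apply: ps_sub; last by exists U.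
  by rewrite ltnNge -[X in X <= _]card_ord -cardsT; apply: contra UT => /(conj (subsetT U))/andP; rewrite -eqEcard.
- have [cr0 sub _] := cr; have := core_uniq cr0.
  rewrite /= !inE !negb_or => /and4P[/and3P[wx _ _] _ _ _].
  apply/card_gt1P; exists w, x; split=> //; apply: sub; by rewrite !inE eqxx ?orbT.
- by move=> dec; have [A] := pattern_splits ltE dec; apply: nsplit.
by move=> c d; apply: (core_corners ltE cr cr').
Qed.

(** * Inflations and their blocks *)

(** [f] sends each point of [U] to the index of its block in an inflation of the word
    [q].  Points are compared as their blocks are, and each block is decreasing. *)
Definition inflates (T : finType) (p v : T -> nat) (q : seq nat) (U : {set T}) f :=
  [/\ {in U &, forall x y, f x < f y -> p x < p y},
      {in U &, forall x y, nth 0 q (f x) < nth 0 q (f y) -> v x < v y} &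
      {in U &, forall x y, f x = f y -> p x < p y -> v y < v x}].

(** The number of points in the blocks placed below block [i]. *)
Definition offset (q l : seq nat) i := \sum_(j < size q | nth 0 q j < nth 0 q i) nth 0 l j.

Lemma offset_le q l i j : i < size q -> nth 0 q i < nth 0 q j ->
  offset q l i + nth 0 l i <= offset q l j.
Proof.
move=> lti ltq; rewrite /offset [leqRHS](bigD1 (Ordinal lti)) //= addnC leq_add2l.
rewrite [leqRHS](bigID (fun k : 'I_(size q) => nth 0 q k < nth 0 q i)) /=.
apply: leq_trans (leq_addr _ _); apply: eq_leq; apply: eq_bigl => k.
have [ki|_] := ltnP (nth 0 q k) (nth 0 q i); last by rewrite andbF.
by rewrite andbT (ltn_trans ki ltq) /=; apply/esym; apply: contraTneq ki => ->; rewrite ltnn.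
Qed.

Lemma inflation_inflates m (t : 'S_m) q l :
  size l = size q -> all (leq 1) l -> oneline t = inflation q l ->
  exists2 f, inflates (@posn m) (valn t) q setT f &
    (forall i, f i < size q) /\ (forall b, b < size q -> exists i, f i = b).
Proof.
move=> sz_l l_gt0 defT; set ss := [seq rev (iota (offset q l i).+1 (nth 0 l i)) | i <- iota 0 (size q)].
have shapeE : shape ss = l.
  rewrite /shape -map_comp -[RHS](mkseq_nth 0) sz_l; apply: eq_map => i /=.
  by rewrite size_rev size_iota.
have sz_m : m = sumn l by rewrite -shapeE -size_flatten -(size_oneline t) defT.
have idx_lt (i : 'I_m) : reshape_index l i < size q.
  by rewrite -sz_l reshape_indexP // -sz_m.
have off_lt (i : 'I_m) : reshape_offset l i < nth 0 l (reshape_index l i).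
  by rewrite reshape_offsetP // -sz_m.
have tE (i : 'I_m) : t i = offset q l (reshape_index l i) +
    (nth 0 l (reshape_index l i) - (reshape_offset l i).+1) :> nat.
  apply: succn_inj; rewrite -nth_oneline defT [inflation q l]/(flatten ss).
  rewrite nth_flatten shapeE (nth_map 0) ?size_iota // nth_iota // add0n.
  rewrite nth_rev ?size_iota // nth_iota ?addSn //.
  by rewrite -subSn // subSS leq_subr.
exists (fun i : 'I_m => reshape_index l i).
  split=> i j _ _; rewrite /posn /valn.
  - by apply: contraTT; rewrite -!leqNgt (reshape_leq l) => /orP[/ltnW|/andP[/eqP-> _]].
  - move=> /(offset_le l (idx_lt i)) le_off; rewrite !tE.
    apply: leq_trans (leq_trans le_off (leq_addr _ _)).
    by rewrite -addnS leq_add2l; move: (off_lt i); clear; lia.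
  move=> eq_idx; rewrite ltnNge (reshape_leq l) eq_idx ltnn eqxx /= -ltnNge => lt_off.
  rewrite !tE eq_idx ltn_add2l; move: lt_off (off_lt j); clear; lia.
split=> [//|b ltb].
have lb : 0 < nth 0 l b by apply: (allP l_gt0); rewrite mem_nth ?sz_l.
have lt : flatten_index l b 0 < m.
  by rewrite sz_m flatten_indexP.
by exists (Ordinal lt); rewrite /= flatten_indexKl.
Qed.

Lemma card_ltv n (s : 'S_n) i : #|[set j | s j < s i]| = s i.
Proof.
apply: succn_inj; rewrite oneline_count.
rewrite (_ : [set j | s j <= s i] = i |: [set j | s j < s i]).
  by rewrite cardsU1 !inE ltnn.
apply/setP => j; rewrite !inE leq_eqVlt; congr (_ || _).
by rewrite (inj_eq val_inj) (inj_eq perm_inj).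
Qed.

Lemma enum_blocks n (f : 'I_n -> nat) k :
  (forall i j : 'I_n, f i < f j -> i < j) ->
  enum [set i | f i < k] = flatten [seq enum [set i | f i == b] | b <- iota 0 k].
Proof.
move=> mono; elim: k => [|k IHk].
  have -> : [set i | f i < 0] = set0 by apply/setP => i; rewrite !inE.
  by rewrite enum_set0.
rewrite -addn1 iotaD map_cat flatten_cat -IHk /= cats0 addn1 add0n.
rewrite (@enum_split n [set i | f i < k]).
- congr (_ ++ _); have -> // : [set i | f i == k] = [set i | f i < k.+1] :\: [set i | f i < k].
  by apply/setP => i; rewrite !inE ltnS -leqNgt andbC -eqn_leq.
- by apply/subsetP => i; rewrite !inE => /ltnW.
move=> i j; rewrite !inE -leqNgt => ltik /andP[lekj _].
exact/mono/(leq_trans ltik).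
Qed.

(** Conversely blocks determine the permutation: cutting the one-line word along
    the blocks, each piece is a decreasing list with as many letters as the interval
    of values reserved for its block, and lies in that interval. *)
Lemma inflates_tower n (s : 'S_n) q f :
  q \in tower_bases -> inflates (@posn n) (valn s) q setT f ->
  (forall i, f i < size q) -> (forall b, b < size q -> exists i, f i = b) -> tower s.
Proof.
move=> q_base [f_p f_v f_dec] f_lt f_surj.
have Uq : uniq q by apply: (allP (_ : all uniq tower_bases)).
pose blk b := [set i | f i == b].
pose l := [seq #|blk b| | b <- iota 0 (size q)].
have sz_l : size l = size q by rewrite size_map size_iota.
have lE b : b < size q -> nth 0 l b = #|blk b|.
  by move=> ltb; rewrite (nth_map 0) ?size_iota // nth_iota.
have offE b : offset q l b = #|[set i | nth 0 q (f i) < nth 0 q b]|.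
  rewrite -sum1_card (eq_bigl (fun i => nth 0 q (f i) < nth 0 q b)); last by move=> i; rewrite inE.
  rewrite (partition_big (fun i => Ordinal (f_lt i)) (fun j => nth 0 q j < nth 0 q b)) //=.
  apply: eq_bigr => j ltj; rewrite lE // -sum1_card; apply: eq_bigl => i.
  rewrite inE -val_eqE /=; case: eqP => [->|]; by rewrite ?ltj ?andbF.
exists q, l; split=> //.
  apply/allP => y /mapP[b]; rewrite mem_iota => /f_surj[i fi] ->.
  by apply/card_gt0P; exists i; rewrite inE fi.
rewrite /oneline -enum_setT_ord.
have -> : [set: 'I_n] = [set i | f i < size q] by apply/setP => i; rewrite !inE f_lt.
rewrite enum_blocks; last by move=> i j; apply: f_p; rewrite inE.
rewrite map_flatten -map_comp; congr flatten; apply/eq_in_map => b.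
rewrite mem_iota /= => ltb; rewrite -[LHS]revK; congr rev.
rewrite -/(offset q l b) lE //; set w := rev _.
have w_sorted : sorted ltn w.
  rewrite rev_sorted sorted_map.
  apply: (sub_in_sorted (P := mem (blk b)) (e := @ltord n)) (sorted_enum _).
    move=> i j; rewrite !inE => /eqP fi /eqP fj ltij.
    by rewrite /= ltnS; apply: f_dec; rewrite ?inE // fi fj.
  by apply/allP => i; rewrite mem_enum.
apply: (irr_sorted_eq ltn_trans ltnn w_sorted (iota_ltn_sorted _ _)).
have sub : {subset w <= iota (offset q l b).+1 #|blk b|}.
  move=> y; rewrite mem_rev => /mapP[i]; rewrite mem_enum inE => /eqP fi ->.
  rewrite mem_iota offE; apply/andP; split.
    rewrite ltnS -[leqRHS]card_ltv; apply/subset_leq_card/subsetP => j; rewrite !inE -fi.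
    by apply: f_v; rewrite inE.
  rewrite addSn ltnS oneline_count (leq_trans _ (leq_card_setU _ _)) //.
  apply/subset_leq_card/subsetP => j; rewrite !inE -fi => le_ji.
  have [//|lt|eq] := ltngtP (nth 0 q (f j)) (nth 0 q (f i)).
    by rewrite leqNgt (_ : _ < _) in le_ji => //; apply: f_v; rewrite ?inE.
  by rewrite -(nth_uniq 0 (f_lt j) (f_lt i) Uq) eq eqxx orbT.
have [] // := uniq_min_size _ sub.
- exact: sorted_uniq ltn_trans ltnn _ w_sorted.
- by rewrite size_iota size_rev size_map cardE.
Qed.

(** * Gluing small towers *)

(** All tower bases except 4231 are obtained from 5274163 by keeping the letters
    5, 7, 1, 3 at the indices 0, 2, 4, 6, which carry the corners W, N, S, E, and
    omitting at least one of the three other letters.  Speaking of blocks of this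
    one word makes towers on different subsets comparable. *)
Definition full_word := [:: 5; 2; 7; 4; 1; 6; 3].

(** [B] lists the indices of letters of [full_word] forming the pattern [q]. *)
Definition embeds q B :=
  [&& size B == size q, sorted ltn B &
      all (fun i => all (fun j => (nth 0 q i < nth 0 q j) ==
        (nth 0 full_word (nth 0 B i) < nth 0 full_word (nth 0 B j)))
        (iota 0 (size q))) (iota 0 (size q))].

Definition tower_blocks := [::
  ([:: 3; 4; 1; 2], [:: 0; 2; 4; 6]);
  ([:: 3; 5; 1; 4; 2], [:: 0; 2; 4; 5; 6]);
  ([:: 4; 2; 5; 1; 3], [:: 0; 1; 2; 4; 6]);
  ([:: 4; 5; 3; 1; 2], [:: 0; 2; 3; 4; 6]);
  ([:: 4; 2; 6; 1; 5; 3], [:: 0; 1; 2; 4; 5; 6]);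
  ([:: 4; 6; 3; 1; 5; 2], [:: 0; 2; 3; 4; 5; 6]);
  ([:: 5; 2; 6; 4; 1; 3], [:: 0; 1; 2; 3; 4; 6])].

Lemma tower_blocks_embeds qB : qB \in tower_blocks -> embeds qB.1 qB.2.
Proof. by move=> qBin; apply: (allP (_ : all (fun qB => embeds qB.1 qB.2) tower_blocks)). Qed.

Section Inflates.
Variables (T : finType) (p v : T -> nat) (U : {set T}) (q B : seq nat).
Hypothesis embB : embeds q B.

Let wordE i j : i < size q -> j < size q -> (nth 0 q i < nth 0 q j) =
  (nth 0 full_word (nth 0 B i) < nth 0 full_word (nth 0 B j)).
Proof.
move=> lti ltj; case/and3P: embB => _ _ /allP/(_ i); rewrite mem_iota => /(_ lti).
by move/allP/(_ j); rewrite mem_iota => /(_ ltj)/eqP.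
Qed.

Let posE i j : i < size q -> j < size q -> (nth 0 B i < nth 0 B j) = (i < j).
Proof.
case/and3P: embB => /eqP szB sB _; rewrite -szB => lti ltj.
have mono := sorted_ltn_nth ltn_trans 0 sB.
have [ltij|ltji|->] := ltngtP i j; last by rewrite ltnn.
  exact: mono.
by apply/negbTE; rewrite -leqNgt ltnW // mono.
Qed.

Lemma inflates_embed f : {in U, forall x, f x < size q} ->
  inflates p v q U f -> inflates p v full_word U (fun x => nth 0 B (f x)).
Proof.
move=> f_lt [f_p f_v f_dec]; split=> x y xU yU.
- by rewrite posE ?f_lt //; apply: f_p.
- by rewrite -wordE ?f_lt //; apply: f_v.
move=> eq_B; apply: f_dec => //; have := posE (f_lt x xU) (f_lt y yU).
by have := posE (f_lt y yU) (f_lt x xU); rewrite eq_B ltnn; case: ltngtP.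
Qed.

Lemma inflates_restrict f : {in U, forall x, f x \in B} ->
  inflates p v full_word U f -> inflates p v q U (fun x => index (f x) B).
Proof.
case/and3P: (embB) => /eqP szB _ _ fB [f_p f_v f_dec].
have lt x : x \in U -> index (f x) B < size q by move=> xU; rewrite -szB index_mem fB.
split=> x y xU yU.
- by rewrite -posE ?lt // !nth_index ?fB //; apply: f_p.
- by rewrite wordE ?lt // !nth_index ?fB //; apply: f_v.
by move/(congr1 (nth 0 B)); rewrite !nth_index ?fB //; apply: f_dec.
Qed.

End Inflates.

Section Corners.
Variables (T : finType) (p v : T -> nat) (U : {set T}) (W N S E : T).
Hypothesis p_inj : injective p.
Hypotheses (WU : W \in U) (NU : N \in U) (SU : S \in U) (EU : E \in U).
Hypotheses (Wfirst : {in U, forall x, p W <= p x}) (Elast : {in U, forall x, p x <= p E}).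
Hypotheses (Slow : {in U, forall x, v S <= v x}) (Nhigh : {in U, forall x, v x <= v N}).

(** The block of a point in a tower whose corners form a 3412, computed from its
    comparisons with the corners alone; being independent of the tower, it can be
    used for all points of the permutation at once. *)
Definition block3412 z :=
  if p z < p N then (if v z < v E then 1 else 0)
  else if v W < v z then (if p z < p S then 2 else 5)
  else if p S < p z then 6 else if v z < v E then 4 else 3.

Definition inflates3412 f :=
  [/\ inflates p v full_word U f, {in U, forall x, f x < 7},
      forall b, b \in [:: 0; 2; 4; 6] -> exists2 x, x \in U & f x = b &
      exists2 b, b \in [:: 1; 3; 5] & {in U, forall x, f x != b}].

Definition inflates4231 f :=
  [/\ inflates p v [:: 4; 2; 3; 1] U f, {in U, forall x, f x < 4} &
      forall b, b < 4 -> exists2 x, x \in U & f x = b].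

Section First.
Variable f : T -> nat.
Hypothesis f_infl : inflates3412 f.

(** All four extreme blocks are occupied, so the extreme points of [U] lie there. *)
Lemma corner_blocks3412 : [/\ f W = 0, f N = 2, f S = 4 & f E = 6].
Proof.
have [[f_p f_v f_dec] f_lt f_hit _] := f_infl.
have [x0 x0U fx0] := f_hit 0 isT; have [x2 x2U fx2] := f_hit 2 isT.
have [x4 x4U fx4] := f_hit 4 isT; have [x6 x6U fx6] := f_hit 6 isT.
split.
- have := Wfirst x0U; case fW : (f W) => [//|b] le.
  by have := f_p _ _ x0U WU; rewrite fx0 fW => /(_ isT); rewrite ltnNge le.
- have := Nhigh x2U; have := f_lt N NU; have := f_v _ _ NU x2U; rewrite fx2.
  by case: (f N) => [|[|[|[|[|[|[|]]]]]]] //= /(_ isT); rewrite ltnNge => /negbTE->.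
- have := Slow x4U; have := f_lt S SU; have := f_v _ _ x4U SU; rewrite fx4.
  by case: (f S) => [|[|[|[|[|[|[|]]]]]]] //= /(_ isT); rewrite ltnNge => /negbTE->.
have := Elast x6U; have := f_lt E EU; have := f_p _ _ EU x6U; rewrite fx6.
by case: (f E) => [|[|[|[|[|[|[|]]]]]]] //= /(_ isT); rewrite ltnNge => /negbTE->.
Qed.

Lemma order3412 : [/\ p W < p N, p N < p S & p S < p E] /\
  [/\ v S < v E, v E < v W & v W < v N].
Proof.
have [fW fN fS fE] := corner_blocks3412; have [[f_p f_v _] _ _ _] := f_infl.
by split; split; (apply: f_p || apply: f_v); rewrite ?fW ?fN ?fS ?fE.
Qed.

Lemma block3412E z : z \in U -> f z = block3412 z.
Proof.
have [fW fN fS fE] := corner_blocks3412.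
have [[f_p f_v f_dec] f_lt _ _] := f_infl.
move=> zU; rewrite /block3412.
have := f_p _ _ zU NU; have := f_p _ _ NU zU; have := f_p _ _ zU SU; have := f_p _ _ SU zU.
have := f_v _ _ zU WU; have := f_v _ _ WU zU; have := f_v _ _ zU EU; have := f_v _ _ EU zU.
have := f_dec _ _ zU NU; have := f_dec _ _ SU zU.
have := f_lt z zU; have := Nhigh zU; have := Slow zU; rewrite fW fN fS fE.
move: (p z) (v z); clear; move=> a b.
case: (f z) => [|[|[|[|[|[|[|]]]]]]] //=.
all: case: (ltnP a (p N)) (ltnP b (v E)) (ltnP (v W) b) (ltnP a (p S)) (ltnP (p S) a)
  => ? [?|?] [?|?] [?|?] [?|?] //; try lia.
Qed.
End First.

(** The analogue for the base 4231: [x0] and [y0] are fixed points of the two middle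
    blocks. *)
Definition block4231 x0 y0 z :=
  if p z < p x0 then (if v y0 < v z then 0 else 1)
  else if v x0 < v z then 2 else if p z < p y0 then 1 else 3.

Section Second.
Variable f : T -> nat.
Hypothesis f_infl : inflates4231 f.

(** The first block is also the highest one and is decreasing, so its first point
    is its highest point. *)
Lemma corner_blocks4231 : [/\ f W = 0, f S = 3, W = N & S = E].
Proof.
have [[f_p f_v f_dec] f_lt f_hit] := f_infl.
have [x0 x0U fx0] := f_hit 0 isT; have [x3 x3U fx3] := f_hit 3 isT.
have fW : f W = 0.
  have := Wfirst x0U; case fW : (f W) => [//|b] le.
  by have := f_p _ _ x0U WU; rewrite fx0 fW => /(_ isT); rewrite ltnNge le.
have fE : f E = 3.
  have := Elast x3U; have := f_lt E EU; have := f_p _ _ EU x3U; rewrite fx3.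
  by case: (f E) => [|[|[|[|]]]] //= /(_ isT); rewrite ltnNge => /negbTE->.
have fN : f N = 0.
  have := Nhigh x0U; have := f_lt N NU; have := f_v _ _ NU x0U; rewrite fx0.
  by case: (f N) => [|[|[|[|]]]] //= /(_ isT); rewrite ltnNge => /negbTE->.
have fS : f S = 3.
  have := Slow x3U; have := f_lt S SU; have := f_v _ _ x3U SU; rewrite fx3.
  by case: (f S) => [|[|[|[|]]]] //= /(_ isT); rewrite ltnNge => /negbTE->.
split=> //; apply: p_inj; apply/eqP; rewrite eqn_leq.
  rewrite Wfirst //= leqNgt; apply/negP => /(f_dec _ _ WU NU (etrans fW (esym fN))).
  by rewrite ltnNge Nhigh.
rewrite Elast //= leqNgt; apply/negP => /(f_dec _ _ SU EU (etrans fS (esym fE))).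
by rewrite ltnNge Slow.
Qed.

Lemma block4231E x0 y0 z : x0 \in U -> y0 \in U -> f x0 = 1 -> f y0 = 2 ->
  z \in U -> f z = block4231 x0 y0 z.
Proof.
have [[f_p f_v f_dec] f_lt _] := f_infl.
move=> xU yU fx fy zU; rewrite /block4231.
have := f_p _ _ zU xU; have := f_p _ _ xU zU; have := f_p _ _ zU yU; have := f_p _ _ yU zU.
have := f_v _ _ zU xU; have := f_v _ _ xU zU; have := f_v _ _ zU yU; have := f_v _ _ yU zU.
have := f_dec _ _ xU zU.
have : p z = p x0 -> v z = v x0 by move/p_inj->.
have := f_p _ _ xU yU; have := f_v _ _ xU yU.
have := f_lt z zU; rewrite fx fy.
move: (p z) (v z); clear; move=> a b.
case: (f z) => [|[|[|[|]]]] //=.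
all: case: (ltnP a (p x0)) (ltnP (v y0) b) (ltnP (v x0) b) (ltnP a (p y0))
  => ? [?|?] [?|?] [?|?] //; try lia.
Qed.

End Second.

(** In every tower base the first letter exceeds the last one and the largest
    letter precedes the smallest one. *)
Lemma tower_adj : (exists f, inflates3412 f) \/ (exists f, inflates4231 f) ->
  adj p v W E /\ adj p v S N.
Proof.
rewrite /adj /nw; case=> -[f f_infl].
  by have [[WN NS SE] [vSE EW vWN]] := order3412 f_infl; split; lia.
have [fW fS <- <-] := corner_blocks4231 f_infl.
have [[f_p f_v _] _ _] := f_infl.
have : p W < p S by apply: f_p; rewrite ?fW ?fS.
have : v S < v W by apply: f_v; rewrite ?fW ?fS.
by split; lia.
Qed.
End Corners.

Section Critical.
Variables (n : nat) (s : 'S_n).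
Let p := @posn n.
Let v := valn s.
Let p' := @rposn n.
Let v' := rvaln s.
Let rev_p : reversed p p' := @rev_posn n.
Let rev_v : reversed v v' := rev_valn s.

Lemma tower_inflates (U : {set 'I_n}) (t : 'S_#|U|) :
  (forall i j, (t i < t j) = (s (enum_val i) < s (enum_val j))) -> tower t ->
  (exists f, inflates3412 p v U f) \/ (exists f, inflates4231 p v U f).
Proof.
move=> ltE [q [l [q_base sz_l l_gt0 defT]]].
have [f0 [f_p f_v f_dec] [f_lt f_surj]] := inflation_inflates sz_l l_gt0 defT.
pose f x := if [pick i : 'I_#|U| | enum_val i == x] is Some i then f0 i else 0.
have fE i : f (enum_val i) = f0 i.
  rewrite /f; case: pickP => [j /eqP/enum_val_inj->//|/(_ i)].
  by rewrite eqxx.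
have f_infl : inflates p v q U f.
  split=> _ _ /rankP[i ->] /rankP[j ->]; rewrite !fE /p /v /posn /valn ?enum_val_mono -?ltE.
  - by apply: f_p; rewrite inE.
  - by apply: f_v; rewrite inE.
  by apply: f_dec; rewrite inE.
have {}f_lt : {in U, forall x, f x < size q} by move=> _ /rankP[i ->]; rewrite fE.
have {}f_surj b : b < size q -> exists2 x, x \in U & f x = b.
  by case/f_surj => i fi; exists (enum_val i); rewrite ?enum_valP ?fE.
have [q4231|q_other] := eqVneq q [:: 4; 2; 3; 1].
  by right; exists f; subst q.
left; have [B qB] : exists B, (q, B) \in tower_blocks.
  have : q \in unzip1 tower_blocks.
    have := allP (isT : all (fun q => (q == [:: 4; 2; 3; 1]) || (q \in unzip1 tower_blocks))
      tower_bases) q q_base.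
    by rewrite (negbTE q_other).
  by case/mapP=> -[q' B] qB ->; exists B.
have embB := tower_blocks_embeds qB; have /and3P[/eqP szB _ _] := embB.
have /and3P[/allP B_lt /allP B_hit /hasP[b b135 bB]] :=
  allP (isT : all (fun qB => [&& all (ltn^~ 7) qB.2, all (mem qB.2) [:: 0; 2; 4; 6] &
     has (fun b => b \notin qB.2) [:: 1; 3; 5]]) tower_blocks) _ qB.
rewrite /= in szB B_lt B_hit bB.
have inB x : x \in U -> nth 0 B (f x) \in B by move=> xU; rewrite mem_nth ?szB ?f_lt.
exists (fun x => nth 0 B (f x)); split; first exact: (inflates_embed embB f_lt f_infl).
- by move=> x xU; apply/B_lt/inB.
- move=> c /B_hit /(nthP 0)[i]; rewrite szB => /f_surj[x xU fx] <-.
  by exists x; rewrite // fx.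
by exists b => // x xU; apply: contraNneq bB => <-; apply: inB.
Qed.

(** W belongs to the lower summand and E to the upper one. *)
Lemma tight_nsplits (U : {set 'I_n}) w x y s0 e x' y' n0 : adj p v w e ->
  core_in p v U w x y s0 -> core_in p' v' U e x' y' n0 ->
  forall A, ~ splits p v U A.
Proof.
move=> we cr cr' A split_A.
have [sub sub'] := splits_cores rev_p rev_v split_A cr cr'.
have wA : w \in A by apply: sub; rewrite mem_head.
have [_ /(_ e (mem_head _ _)) eU _] := cr'.
have := splits_closed split_A wA eU we.
by rewrite (negbTE (sub' e (mem_head _ _))).
Qed.

Hypothesis crit : critical s.

Lemma critical_tower (U : {set 'I_n}) w x y s0 e x' y' n0 : U != setT ->
  core_in p v U w x y s0 -> core_in p' v' U e x' y' n0 ->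
  (forall A, ~ splits p v U A) ->
  (exists f, inflates3412 p v U f) \/ (exists f, inflates4231 p v U f).
Proof.
move=> UT cr cr' nsplit; have [t [tw ltE]] := critical_proper crit UT cr cr' nsplit.
exact: tower_inflates ltE tw.
Qed.

Lemma core_in_corners (U : {set 'I_n}) w x y s0 e x' y' n0 :
  core_in p v U w x y s0 -> core_in p' v' U e x' y' n0 ->
  [/\ [/\ w \in U, n0 \in U, s0 \in U & e \in U],
      {in U, forall z, p w <= p z} /\ {in U, forall z, p z <= p e} &
      {in U, forall z, v s0 <= v z} /\ {in U, forall z, v z <= v n0}].
Proof.
move=> [_ sub lim] [_ sub' lim']; split.
- by split; [apply: sub | apply: sub' | apply: sub | apply: sub']; rewrite !inE eqxx ?orbT.
- split=> z zU; first exact: (lim z zU).1.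
  by rewrite leqNgt -rev_p -leqNgt (lim' z zU).1.
split=> z zU; first exact: (lim z zU).2.
by rewrite leqNgt -rev_v -leqNgt (lim' z zU).2.
Qed.

Lemma critical_proper_sets_tight : proper_sets_tight p v p' v'.
Proof.
move=> U w x y s0 e x' y' n0 UT cr cr' nsplit.
have tw := critical_tower UT cr cr' nsplit.
have [[wU nU sU eU] [wlim elim] [slim nlim]] := core_in_corners cr cr'.
exact: (tower_adj (@posn_inj n) wU nU sU eU wlim elim slim nlim tw).
Qed.

Hypothesis n_ge9 : 9 <= n.

Lemma small_neq_setT (U : {set 'I_n}) : #|U| < 9 -> U != setT.
Proof. by apply: contraTneq => ->; rewrite cardsT card_ord -leqNgt. Qed.


Lemma card_seq_lt9 (r : seq 'I_n) : size r < 9 -> [set t in r] != setT.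
Proof.
move=> ltr; apply: small_neq_setT; apply: leq_ltn_trans ltr.
by rewrite cardsE card_size.
Qed.

Section NoTower.
Variables W N S E : 'I_n.
Hypotheses (Wfirst : forall z, p W <= p z) (Elast : forall z, p z <= p E).
Hypotheses (Slow : forall z, v S <= v z) (Nhigh : forall z, v z <= v N).

Let revle (f f' : 'I_n -> nat) : reversed f f' -> forall x y, f x <= f y -> f' y <= f' x.
Proof. by move=> rev_f x y; rewrite leqNgt -rev_f -leqNgt. Qed.

(** A tower on some [U] containing the corners puts the corners in the order 3412.
    The block function [block3412] is then correct for any two points, as one sees
    on the tower formed by these and the corners.  Nor can the blocks 1, 3 and 5 all
    be occupied: three points in them would form with the corners the pattern
    5274163, which is not a tower.  So the whole permutation is a tower. *)
Lemma no_tower3412 (U : {set 'I_n}) f :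
  W \in U -> N \in U -> S \in U -> E \in U -> ~ inflates3412 p v U f.
Proof.
move=> WU NU SU EU f_infl.
have [[WN NS SE] [vSE EW vWN]] : [/\ p W < p N, p N < p S & p S < p E] /\
    [/\ v S < v E, v E < v W & v W < v N].
  by apply: (order3412 WU NU SU EU _ _ _ _ f_infl) => z _.
have [corW corE] := cores_of_3412 rev_p rev_v WN NS SE vSE EW vWN.
(* at most eight points, fewer than n: the pattern on V r is a tower *)
pose V r := [set t in [:: W, N, S, E & r]].
have [WV NV SV EV] : [/\ forall r, W \in V r, forall r, N \in V r, forall r, S \in V r & forall r, E \in V r].
  by split=> r; rewrite inE !inE eqxx ?orbT.
have V_infl r : size r < 5 -> exists f1, inflates3412 p v (V r) f1.
  move=> ltr.
  have cr1 : core_in p v (V r) W N E S.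
    by split=> // z; rewrite !inE => /or4P[] /eqP->; rewrite eqxx ?orbT.
  have cr2 : core_in p' v' (V r) E S W N.
    split=> // [z|z _]; first by rewrite !inE => /or4P[] /eqP->; rewrite eqxx ?orbT.
    by split; apply: revle.
  have WE : adj p v W E by rewrite /adj /nw; lia.
  have VT : V r != setT by apply: card_seq_lt9; rewrite /= !ltnS.
  have [//|[f1 f1_infl]] := critical_tower VT cr1 cr2 (tight_nsplits WE cr1 cr2).
  have [_ _ EN _] := corner_blocks4231 (@posn_inj n) (WV r) (NV r) (SV r) (EV r)
    (in1W Wfirst) (in1W Elast) (in1W Slow) (in1W Nhigh) f1_infl.
  by move: WN; rewrite EN ltnn.
pose k := block3412 p v W N S E.
have kE r f1 z : inflates3412 p v (V r) f1 -> z \in V r -> f1 z = k z.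
  move=> f1_infl zV; rewrite /k.
  by have := block3412E (WV r) (NV r) (SV r) (EV r) (in1W Wfirst) (in1W Elast)
    (in1W Slow) (in1W Nhigh) f1_infl zV.
have k_infl : inflates p v full_word setT k.
  have two x y : exists f1, [/\ inflates p v full_word (V [:: x; y]) f1,
      f1 x = k x, f1 y = k y, x \in V [:: x; y] & y \in V [:: x; y]].
    have [f1 f1_infl] := V_infl [:: x; y] isT.
    have xV : x \in V [:: x; y] by rewrite !inE eqxx !orbT.
    have yV : y \in V [:: x; y] by rewrite !inE eqxx !orbT.
    by exists f1; split=> //; [case: f1_infl | apply: kE xV | apply: kE yV].
  by split=> x y _ _; have [f1 [[f_p f_v f_dec] <- <- xV yV]] := two x y;
    [apply: f_p | apply: f_v | apply: f_dec].
have k_lt x : k x < 7 by rewrite /k /block3412; do !case: ifP => _.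
have k_hit b : b \in [:: 0; 2; 4; 6] -> exists x, k x = b.
  have [f1 f1_infl] := V_infl [::] isT; have [_ _ hit _] := f1_infl.
  by case/hit => x xV <-; exists x; rewrite (kE _ _ _ f1_infl xV).
have k_miss x y z : k x = 1 -> k y = 3 -> k z = 5 -> False.
  have [f1 f1_infl] := V_infl [:: x; y; z] isT; have [_ _ _ [b b135 miss]] := f1_infl.
  move=> kx ky kz; move: b135; rewrite !inE => /or3P[] /eqP bE.
  - by have := miss x; rewrite (kE _ _ _ f1_infl) !inE eqxx ?orbT // kx bE => /(_ isT).
  - by have := miss y; rewrite (kE _ _ _ f1_infl) !inE eqxx ?orbT // ky bE => /(_ isT).
  - by have := miss z; rewrite (kE _ _ _ f1_infl) !inE eqxx ?orbT // kz bE => /(_ isT).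
have [_ _ _ ntower] := critical_bad crit.
pose hit b := [exists x, k x == b].
have hitP b : hit b -> exists x, k x = b by move=> /existsP[x /eqP]; exists x.
have tow q B : (q, B) \in tower_blocks -> {in B, forall b, exists x, k x = b} ->
    (forall x, k x \in B) -> False.
  move=> qB B_hit kB; apply: ntower.
  have embB := tower_blocks_embeds qB; have /and3P[/eqP szB srtB _] := embB.
  rewrite /= in szB srtB embB.
  have q_base : q \in tower_bases.
    exact: (allP (isT : all (fun qB => qB.1 \in tower_bases) tower_blocks) _ qB).
  apply: (inflates_tower q_base (inflates_restrict embB (in1W kB) k_infl)).
    by move=> i; rewrite -szB index_mem.
  move=> b; rewrite -szB => ltb; have [x kx] := B_hit _ (mem_nth 0 ltb).
  by exists x; rewrite kx index_uniq // (sorted_uniq ltn_trans ltnn).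
have kin B : {subset [:: 0; 2; 4; 6] <= B} -> (hit 1 -> 1 \in B) ->
    (hit 3 -> 3 \in B) -> (hit 5 -> 5 \in B) -> forall x, k x \in B.
  move=> sB h1 h3 h5 x; have := k_lt x; case kx: (k x) => [|[|[|[|[|[|[|]]]]]]] // _;
    try by apply: sB.
  - by apply: h1; apply/existsP; exists x; rewrite kx.
  - by apply: h3; apply/existsP; exists x; rewrite kx.
  by apply: h5; apply/existsP; exists x; rewrite kx.
have all_hit B : all (fun b => (b \in [:: 0; 2; 4; 6]) || hit b) B ->
    {in B, forall b, exists x, k x = b}.
  by move=> /allP HB b /HB /orP[/k_hit|/hitP].
have sub4 B : all (mem B) [:: 0; 2; 4; 6] -> {subset [:: 0; 2; 4; 6] <= B} by move/allP.
case h1 : (hit 1); case h3 : (hit 3); case h5 : (hit 5).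
- by have [[x kx] [y ky] [z kz]] := And3 (hitP _ h1) (hitP _ h3) (hitP _ h5); apply: k_miss kx ky kz.
- apply: (tow [:: 5; 2; 6; 4; 1; 3] [:: 0; 1; 2; 3; 4; 6]) => //.
    by apply: all_hit; rewrite /= h1 h3 ?orbT.
  by apply: kin; rewrite ?h1 ?h3 ?h5 //; apply: sub4.
- apply: (tow [:: 4; 2; 6; 1; 5; 3] [:: 0; 1; 2; 4; 5; 6]) => //.
    by apply: all_hit; rewrite /= h1 h5 ?orbT.
  by apply: kin; rewrite ?h1 ?h3 ?h5 //; apply: sub4.
- apply: (tow [:: 4; 2; 5; 1; 3] [:: 0; 1; 2; 4; 6]) => //.
    by apply: all_hit; rewrite /= h1 ?orbT.
  by apply: kin; rewrite ?h1 ?h3 ?h5 //; apply: sub4.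
- apply: (tow [:: 4; 6; 3; 1; 5; 2] [:: 0; 2; 3; 4; 5; 6]) => //.
    by apply: all_hit; rewrite /= h3 h5 ?orbT.
  by apply: kin; rewrite ?h1 ?h3 ?h5 //; apply: sub4.
- apply: (tow [:: 4; 5; 3; 1; 2] [:: 0; 2; 3; 4; 6]) => //.
    by apply: all_hit; rewrite /= h3 ?orbT.
  by apply: kin; rewrite ?h1 ?h3 ?h5 //; apply: sub4.
- apply: (tow [:: 3; 5; 1; 4; 2] [:: 0; 2; 4; 5; 6]) => //.
    by apply: all_hit; rewrite /= h5 ?orbT.
  by apply: kin; rewrite ?h1 ?h3 ?h5 //; apply: sub4.
apply: (tow [:: 3; 4; 1; 2] [:: 0; 2; 4; 6]) => //.
by apply: kin; rewrite ?h1 ?h3 ?h5 //; apply: sub4.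
Qed.

(** The same gluing, along W, S and one point in each of the middle blocks. *)
Lemma no_tower4231 (U : {set 'I_n}) f :
  W \in U -> N \in U -> S \in U -> E \in U -> ~ inflates4231 p v U f.
Proof.
move=> WU NU SU EU f_infl.
have [fW fS WeqN SeqE] := corner_blocks4231 (@posn_inj n) WU NU SU EU
    (in1W Wfirst) (in1W Elast) (in1W Slow) (in1W Nhigh) f_infl.
have [[f_p f_v f_dec] f_lt f_hit] := f_infl.
have [x0 x0U fx] := f_hit 1 isT; have [y0 y0U fy] := f_hit 2 isT.
have Wx : p W < p x0 by apply: f_p; rewrite ?fW ?fx.
have xy : p x0 < p y0 by apply: f_p; rewrite ?fx ?fy.
have yS : p y0 < p S by apply: f_p; rewrite ?fy ?fS.
have vSx : v S < v x0 by apply: f_v; rewrite ?fS ?fx.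
have vxy : v x0 < v y0 by apply: f_v; rewrite ?fx ?fy.
have vyW : v y0 < v W by apply: f_v; rewrite ?fW ?fy.
have [corW corE] := cores_of_4231 rev_p rev_v Wx xy yS vSx vxy vyW.
pose V r := [set t in [:: W, x0, y0, S & r]].
have [WV xV yV SV] : [/\ forall r, W \in V r, forall r, x0 \in V r, forall r, y0 \in V r & forall r, S \in V r].
  by split=> r; rewrite inE !inE eqxx ?orbT.
have WS : adj p v W S by rewrite /adj /nw; lia.
have V_infl r : size r < 5 -> exists f1, [/\ inflates4231 p v (V r) f1, f1 x0 = 1 & f1 y0 = 2].
  move=> ltr.
  have cr1 : core_in p v (V r) W x0 y0 S.
    by split=> // z; rewrite !inE => /or4P[] /eqP->; rewrite eqxx ?orbT.
  have cr2 : core_in p' v' (V r) S y0 x0 W.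
    split=> // [z|z _]; first by rewrite !inE => /or4P[] /eqP->; rewrite eqxx ?orbT.
    by split; [apply: (revle rev_p); rewrite SeqE | apply: (revle rev_v); rewrite WeqN].
  have VT : V r != setT by apply: card_seq_lt9; rewrite /= !ltnS.
  have Nhigh1 z : v z <= v W by rewrite WeqN.
  have Elast1 z : p z <= p S by rewrite SeqE.
  case: (critical_tower VT cr1 cr2 (tight_nsplits WS cr1 cr2)) => -[f1 f1_infl].
    have [f1W f1N _ _] := corner_blocks3412 (WV r) (WV r) (SV r) (SV r)
      (in1W Wfirst) (in1W Elast1) (in1W Slow) (in1W Nhigh1) f1_infl.
    by rewrite f1W in f1N.
  exists f1; have [f1W f1S _ _] := corner_blocks4231 (@posn_inj n) (WV r) (WV r) (SV r) (SV r)
    (in1W Wfirst) (in1W Elast1) (in1W Slow) (in1W Nhigh1) f1_infl.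
  have [[g_p g_v g_dec] g_lt _] := f1_infl.
  have gx := g_lt _ (xV r); have gy := g_lt _ (yV r).
  (* the only ascent of 4231 is its middle pair *)
  suff [? ?] : f1 x0 = 1 /\ f1 y0 = 2 by split.
  have := g_p _ _ (yV r) (xV r); have := g_v _ _ (yV r) (xV r).
  have := g_dec _ _ (xV r) (yV r).
  move: gx gy xy vxy; clear.
  case: (f1 x0) => [|[|[|[|]]]] //; case: (f1 y0) => [|[|[|[|]]]] //= _ _ xy vxy H1 H2 H3;
    first [ by [] | by have := H1 erefl xy; rewrite ltnNge ltnW
          | by have := H2 isT; rewrite ltnNge ltnW | by have := H3 isT; rewrite ltnNge ltnW].
have k_in r f1 z : inflates4231 p v (V r) f1 -> f1 x0 = 1 -> f1 y0 = 2 -> z \in V r ->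
    f1 z = block4231 p v x0 y0 z.
  by move=> f1_infl f1x f1y; apply: (block4231E (@posn_inj n) f1_infl (xV r) (yV r) f1x f1y).
pose k := block4231 p v x0 y0.
have k_infl : inflates p v [:: 4; 2; 3; 1] setT k.
  have two x y : exists f1, [/\ inflates p v [:: 4; 2; 3; 1] (V [:: x; y]) f1,
      f1 x = k x, f1 y = k y, x \in V [:: x; y] & y \in V [:: x; y]].
    have [f1 [f1_infl f1x f1y]] := V_infl [:: x; y] isT.
    have xVr : x \in V [:: x; y] by rewrite !inE eqxx !orbT.
    have yVr : y \in V [:: x; y] by rewrite !inE eqxx !orbT.
    by exists f1; split=> //; [case: f1_infl | apply: k_in f1x f1y xVr | apply: k_in f1x f1y yVr].
  by split=> x y _ _; have [f1 [[g_p g_v g_dec] <- <- xVr yVr]] := two x y;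
    [apply: g_p | apply: g_v | apply: g_dec].
have [_ _ _ ntower] := critical_bad crit; apply: ntower.
apply: (inflates_tower (q := [:: 4; 2; 3; 1]) _ k_infl) => //.
  by move=> z; rewrite /k /block4231; do !case: ifP => _.
move=> b ltb; have [f1 [f1_infl f1x f1y]] := V_infl [::] isT.
have [_ _ hit] := f1_infl; have [z zV <-] := hit b ltb.
by exists z; rewrite (k_in _ _ _ f1_infl).
Qed.

End NoTower.
End Critical.

(** * Connectedness of the inversion graph *)

(** If [y] is outside the component of the leftmost point [w], the points of this
    component are comparable with [y]; walking along inversions one cannot pass from
    below [y] to above [y], so the whole component is below [y] and it splits off. *)
Lemma connect_splits (T : finType) (p v : T -> nat) (w u : T) :
  injective p -> injective v -> (forall t, p w <= p t) ->
  (forall A, ~ splits p v setT A) -> connect (adj p v) w u.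
Proof.
move=> p_inj v_inj first nsplit; apply: contraT => nwu.
pose A := [set t | connect (adj p v) w t].
case: (nsplit A); split; first exact: subsetT.
- by exists w; rewrite inE connect0.
- by exists u; rewrite !inE nwu.
move=> t y; rewrite !inE andbT => /connectP[q wq ->] nwy {t}.
have ny t : connect (adj p v) w t -> adj p v t y = false.
  by move=> wt; apply: contraNF nwy => ty; apply: connect_trans wt (connect1 ty).
have sw_y t : connect (adj p v) w t -> sw p v t y || sw p v y t.
  move=> wt; have ty : t != y by apply: contraNneq nwy => <-.
  move: (ny t wt) (inj_neq p_inj ty) (inj_neq v_inj ty); rewrite /adj /nw /sw; lia.
have wy : sw p v w y.
  by have := sw_y w (connect0 _ _); case/orP => //; rewrite /sw ltnNge first.
suff walk z : connect (adj p v) w z -> sw p v z y -> path (adj p v) z q ->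
    sw p v (last z q) y by apply: walk (connect0 _ _) wy wq.
elim: q {wq} z => //= t q IHq z wz zy /andP[zt tq].
have wt := connect_trans wz (connect1 zt).
apply: (IHq _ wt _ tq); case/orP: (sw_y t wt) => // yt.
by move: zt zy yt; rewrite /adj /nw /sw; lia.
Qed.

Lemma pattern_on4 n (s : 'S_n) (C : {set 'I_n}) (a b c d : 'I_n) :
  C = [set a; b; c; d] -> a < b -> b < c -> c < d ->
  pattern_on s C = std [:: val (s a); val (s b); val (s c); val (s d)].
Proof.
move=> -> ab bc cd; rewrite /pattern_on.
suff -> : enum [set a; b; c; d] = [:: a; b; c; d] by [].
apply: (irr_sorted_eq (@ltord_trans n)) (sorted_enum _) _ _; first by move=> i; apply: ltnn.
  by rewrite /= /ltord ab bc cd.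
by move=> i; rewrite mem_enum !inE -!orbA.
Qed.

Lemma std3412 a b c d :
  (std [:: a; b; c; d] == [:: 3; 4; 1; 2]) = [&& c < d, d < a & a < b].
Proof.
rewrite /std /= !eqseq_cons !leqnn !addn0.
by case: (ltngtP a b); case: (ltngtP a c); case: (ltngtP a d); case: (ltngtP b c);
   case: (ltngtP b d); case: (ltngtP c d) => //=; lia.
Qed.

Lemma std4231 a b c d :
  (std [:: a; b; c; d] == [:: 4; 2; 3; 1]) = [&& d < b, b < c & c < a].
Proof.
rewrite /std /= !eqseq_cons !leqnn !addn0.
by case: (ltngtP a b); case: (ltngtP a c); case: (ltngtP a d); case: (ltngtP b c);
   case: (ltngtP b d); case: (ltngtP c d) => //=; lia.
Qed.

(** * Translation to positions and values of a permutation *)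

Section Translation.
Variables (n : nat) (s : 'S_n).
Let p := @posn n.
Let v := valn s.
Let p' := @rposn n.
Let v' := rvaln s.
Let rev_p : reversed p p' := @rev_posn n.
Let rev_v : reversed v v' := rev_valn s.
Let p_inj : injective p := @posn_inj n.
Let v_inj : injective v := @valn_inj n s.

Let core_patterns : seq (seq nat) := [:: [:: 3; 4; 1; 2]; [:: 4; 2; 3; 1]].

Lemma set4E (a b c d : 'I_n) : [set a; b; c; d] =i [:: a; b; c; d].
Proof. by move=> t; rewrite !inE -!orbA. Qed.

Ltac permute_set4 := by apply/setP => ?; rewrite !inE; repeat case: (_ == _).

(** Reading the set by increasing position, the same four letters name a core in
    either orientation. *)
Lemma pattern_core (C : {set 'I_n}) : #|C| = 4 -> pattern_on s C \in core_patterns ->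
  (exists w x y s0, core p v w x y s0 /\ C = [set w; x; y; s0]) /\
  (exists e x y n0, core p' v' e x y n0 /\ C = [set e; x; y; n0]).
Proof.
move=> cardC; have := sorted_enum C; have := mem_enum (mem C).
move: cardC; rewrite cardE; case: (enum C) => [|a[|b[|c[|d[|]]]]] //= _ memC.
move=> /and4P[ab bc cd _].
have defC : C = [set a; b; c; d].
  by apply/setP => t; rewrite set4E -[t \in C]memC.
rewrite (pattern_on4 s defC ab bc cd) !inE std3412 std4231.
case/orP => /and3P[v1 v2 v3].
  have [cr cr'] := cores_of_3412 rev_p rev_v ab bc cd v1 v2 v3.
  split; [exists a, b, d, c | exists d, c, a, b]; split=> //; rewrite defC; permute_set4.
have [cr cr'] := cores_of_4231 rev_p rev_v ab bc cd v1 v2 v3.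
split; [exists a, b, c, d | exists d, c, b, a]; split=> //; rewrite defC.
permute_set4.
Qed.

Lemma core_pattern w x y s0 : core p v w x y s0 ->
  #|[set w; x; y; s0]| = 4 /\ pattern_on s [set w; x; y; s0] \in core_patterns.
Proof.
move=> cr; split.
  by rewrite (eq_card (set4E _ _ _ _)); apply/card_uniqP; apply: core_uniq cr.
move: cr; rewrite /core => /and5P[wx xy xs sy /and3P[yw sx /orP[]/andP[py vx]]].
  rewrite (@pattern_on4 _ s _ w x s0 y) //; last by permute_set4.
  by rewrite !inE std3412 sy yw vx.
by rewrite (@pattern_on4 _ s _ w x y s0) // !inE std4231 sx vx yw orbT.
Qed.

Lemma core_flip e x y n0 : core p' v' e x y n0 ->
  exists w x' y' s0, core p v w x' y' s0 /\ [set e; x; y; n0] = [set w; x'; y'; s0].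
Proof.
have [rp rv] := (reversed_sym rev_p, reversed_sym rev_v).
rewrite /core => /and5P[ex xy xn ny /and3P[ye nx /orP[]/andP[pny vex]]].
  have [_ cr] := cores_of_3412 rp rv ex xn pny ny ye vex.
  exists y, n0, e, x; split=> //; permute_set4.
have [_ cr] := cores_of_4231 rp rv ex xy pny nx vex ye.
exists n0, y, x, e; split=> //; permute_set4.
Qed.

Lemma covers_min_inversion (C : {set 'I_n}) i k : covers p v C i k = min_inversion_on s C i k.
Proof.
rewrite /covers /min_inversion_on /inversion /nw /p /v /posn /valn.
congr [&& _, _, _ & ~~ _]; apply: eq_existsb => j.
by case: (_ \in _); case: (i < j); case: (j < k); case: (s j < s i); case: (s k < s j).
Qed.

Lemma cov_adj_min_inversion (C : {set 'I_n}) i k :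
  cov_adj p v C i k = min_inversion_on s C i k || min_inversion_on s C k i.
Proof. by rewrite /cov_adj !covers_min_inversion. Qed.

Lemma cover_graph_cov_adj i k : cover_graph s i k = cov_adj p v setT i k.
Proof.
rewrite cov_adj_min_inversion /cover_graph /Cov /min_inversion_on !inE /=.
by congr (_ && ~~ _ || _ && ~~ _); apply: eq_existsb => j; rewrite inE.
Qed.

Lemma bad_corner_ascent c d : corner_at s c d -> ~ good_corner s c d ->
  exists i j, [/\ i \in window s c d, j \in window s c d & sw p v i j].
Proof.
move=> cd bad; have [/existsP[i /existsP[j /and3P[iw jw ij]]]|no] :=
  boolP [exists i, exists j, [&& i \in window s c d, j \in window s c d & sw p v i j]].
  by exists i, j.
case: bad; split=> // i j iw jw ij; rewrite ltnNge; apply: contra no => le_ij.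
apply/existsP; exists i; apply/existsP; exists j; rewrite iw jw /sw /p /posn ij.
rewrite ltn_neqAle le_ij andbT; apply: contraTneq ij => /v_inj->.
by rewrite ltnn.
Qed.

Lemma in_down c d i : c = W_corner \/ c = N_corner -> (i \in window s c d) = nw p v d i.
Proof. by case=> ->; rewrite inE. Qed.

Lemma in_up c d i : c = S_corner \/ c = E_corner -> (i \in window s c d) = nw p v i d.
Proof. by case=> ->; rewrite inE. Qed.

Variables W N S E : 'I_n.
Hypotheses (Wc : corner_at s W_corner W) (Nc : corner_at s N_corner N).
Hypotheses (Sc : corner_at s S_corner S) (Ec : corner_at s E_corner E).

Lemma corners_lim : (forall t, p W <= p t /\ v S <= v t) /\
  (forall t, p' E <= p' t /\ v' N <= v' t).
Proof.
rewrite /p /v /p' /v' /posn /valn /rposn /rvaln.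
move: Wc Nc Sc Ec => /= /eqP -> /eqP H /eqP -> /eqP H'; split=> // t.
by split; apply: leq_sub2l; rewrite -ltnS ?H ?H' ltn_ord.
Qed.

Lemma corner_uniq c d d' : corner_at s c d -> corner_at s c d' -> d = d'.
Proof.
case: c => /= /eqP H /eqP H'; apply/val_inj => //=.
- by rewrite H H'.
- by congr val; apply: v_inj; apply: succn_inj; rewrite /v /valn H H'.
- by congr val; apply: v_inj; rewrite /v /valn H H'.
by apply: succn_inj; rewrite H H'.
Qed.

Lemma SW_core_points (C : {set 'I_n}) : SW_core s C ->
  exists x y, core p v W x y S /\ C = [set W; x; y; S].
Proof.
case=> cardC patC cornC; have [[w [x [y [s0 [cr defC]]]]] _] := pattern_core cardC patC.
have inC c : c = W_corner \/ c = S_corner -> exists2 d, corner_at s c d & d \in C.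
  by move/cornC => [d /andP[dc dC] _]; exists d.
have [limp limv] := (fun t => (corners_lim.1 t).1, fun t => (corners_lim.1 t).2).
have [d1 d1c d1C] := inC W_corner (or_introl erefl).
have [d2 d2c d2C] := inC S_corner (or_intror erefl).
rewrite -(corner_uniq Wc d1c) defC set4E in d1C.
rewrite -(corner_uniq Sc d2c) defC set4E in d2C.
have eqw : w = W.
  by apply: p_inj; apply/eqP; rewrite eqn_leq limp andbT; have [] := core_min cr d1C.
have eqs : s0 = S.
  by apply: v_inj; apply/eqP; rewrite eqn_leq limv andbT; have [] := core_min cr d2C.
by exists x, y; rewrite -eqw -eqs.
Qed.

Lemma NE_core_points (C : {set 'I_n}) : NE_core s C ->
  exists x y, core p' v' E x y N /\ C = [set E; x; y; N].
Proof.
case=> cardC patC cornC; have [_ [w [x [y [s0 [cr defC]]]]]] := pattern_core cardC patC.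
have inC c : c = N_corner \/ c = E_corner -> exists2 d, corner_at s c d & d \in C.
  by move/cornC => [d /andP[dc dC] _]; exists d.
have [limp limv] := (fun t => (corners_lim.2 t).1, fun t => (corners_lim.2 t).2).
have [d1 d1c d1C] := inC E_corner (or_intror erefl).
have [d2 d2c d2C] := inC N_corner (or_introl erefl).
rewrite -(corner_uniq Ec d1c) defC set4E in d1C.
rewrite -(corner_uniq Nc d2c) defC set4E in d2C.
have eqw : w = E.
  apply: (reversed_inj p_inj rev_p); apply/eqP.
  by rewrite eqn_leq limp andbT; have [] := core_min cr d1C.
have eqs : s0 = N.
  apply: (reversed_inj v_inj rev_v); apply/eqP.
  by rewrite eqn_leq limv andbT; have [] := core_min cr d2C.
by exists x, y; rewrite -eqw -eqs.
Qed.

Lemma core_SW_core x y : core p v W x y S -> SW_core s [set W; x; y; S].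
Proof.
move=> cr; have [cardC patC] := core_pattern cr; split=> //.
have [[i [j [iC jC Wi Wj ij]]] [i' [j' [i'C j'C iS jS ij']]]] := core_ascents cr.
by move=> c [] ->; [exists W | exists S]; rewrite ?Wc ?Sc ?set4E ?inE ?eqxx ?orbT //;
  [exists i, j | exists i', j']; split=> //; rewrite in_setI set4E ?iC ?jC ?i'C ?j'C inE.
Qed.

Lemma core_NE_core x y : core p' v' E x y N -> NE_core s [set E; x; y; N].
Proof.
move=> cr; have [w [x' [y' [s0 [cr' eqC]]]]] := core_flip cr.
have [cardC patC] := core_pattern cr'; split; rewrite ?eqC // -eqC.
have [[i [j [iC jC Ei Ej ij]]] [i' [j' [i'C j'C iN jN ij']]]] := core_ascents cr.
rewrite !(nw_rev rev_p rev_v) !(sw_rev rev_p rev_v) in Ei Ej ij iN jN ij'.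
by move=> c [] ->; [exists N | exists E]; rewrite ?Nc ?Ec ?set4E ?inE ?eqxx ?orbT //;
  [exists j', i' | exists j, i]; split=> //; rewrite in_setI set4E ?iC ?jC ?i'C ?j'C inE.
Qed.

End Translation.

(** * The cover graph of a critical permutation *)

Theorem corollary7p15 (n : nat) (sigma : 'S_n) (n_ge9 : 9 <= n)
    (sigma_critical : critical sigma) :
  exists Cminus Cplus : {set 'I_n},
    [/\ unique (SW_core sigma) Cminus,
        unique (NE_core sigma) Cplus,
        [disjoint Cminus & Cplus] &
        exists cminus cplus : seq 'I_n,
        exists a b : 'I_n,
        exists p : seq 'I_n,
          [/\ core_cycle sigma Cminus cminus,
              core_cycle sigma Cplus cplus,
              dumbbell (cover_graph sigma) cminus cplus a b p &
              size p = n - 8]].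
Proof.
have n_gt0 : 0 < n by apply: leq_trans n_ge9.
have lt_last : n.-1 < n by rewrite prednK.
pose W := Ordinal n_gt0; pose E := Ordinal lt_last.
pose S := (sigma^-1)%g W; pose N := (sigma^-1)%g E.
have Wc : corner_at sigma W_corner W by [].
have Ec : corner_at sigma E_corner E by rewrite /= prednK.
have Sc : corner_at sigma S_corner S by rewrite /= permKV.
have Nc : corner_at sigma N_corner N by rewrite /= permKV /= prednK.
pose p := @posn n; pose v := valn sigma; pose p' := @rposn n; pose v' := rvaln sigma.
have p_inj : injective p := @posn_inj n.
have v_inj : injective v := @valn_inj n sigma.
have rev_p : reversed p p' := @rev_posn n.
have rev_v : reversed v v' := rev_valn sigma.
have p'_inj := reversed_inj p_inj rev_p; have v'_inj := reversed_inj v_inj rev_v.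
have [lim lim'] := corners_lim Wc Nc Sc Ec.
have [_ ndec nogood _] := critical_bad sigma_critical.
have nsplit A : ~ splits p v setT A by move/splits_decomposable; apply: ndec.
have [x [y cr]] : exists x y, core p v W x y S.
  have [i [j [iW jW ij]]] := bad_corner_ascent Wc (nogood _ _).
  have [k [l [kS lS kl]]] := bad_corner_ascent Sc (nogood _ _).
  rewrite !in_down in iW jW; try by left.
  rewrite !in_up in kS lS; try by left.
  exact: (core_exists p_inj v_inj lim iW jW ij kS lS kl).
have [x' [y' cr']] : exists x y, core p' v' E x y N.
  have [i [j [iW jW ij]]] := bad_corner_ascent Ec (nogood _ _).
  have [k [l [kS lS kl]]] := bad_corner_ascent Nc (nogood _ _).
  rewrite !in_up in iW jW; try by right.
  rewrite !in_down in kS lS; try by right.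
  rewrite -!(nw_rev rev_p rev_v) in iW jW kS lS; rewrite -!(sw_rev rev_p rev_v) in ij kl.
  exact: (core_exists p'_inj v'_inj lim' jW iW ij lS kS kl).
pose C := [set W; x; y; S]; pose C' := [set E; x'; y'; N].
have defC : C =i [:: W; x; y; S] := set4E W x y S.
have defC' : C' =i [:: E; x'; y'; N] := set4E E x' y' N.
have WC : W \in C by rewrite defC mem_head.
have EC' : E \in C' by rewrite defC' mem_head.
have in_core (U : {set 'I_n}) : C \subset U -> C' \subset U ->
    core_in p v U W x y S /\ core_in p' v' U E x' y' N.
  by move=> /subsetP sC /subsetP sC'; split; split=> // t; rewrite -?defC -?defC'; [apply: sC | apply: sC'].
have [cardC patC] := core_pattern cr.
have cardC' : #|C'| = 4 by rewrite (eq_card defC'); apply/card_uniqP/(core_uniq cr').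
have sep : {in C & C', forall c c', (c != c') && ~~ adj p v c c'}.
  move=> c c' cC cC'; apply: contraT => /nandP join.
  have [cr1 cr2] := in_core _ (subsetUl C C') (subsetUr C C').
  have UT : C :|: C' != setT.
    apply: (small_neq_setT n_ge9); apply: leq_ltn_trans (leq_card_setU _ _) _.
    by rewrite cardC cardC'.
  have nsplitU A : ~ splits p v (C :|: C') A.
    move=> split_A; have [sub sub'] := splits_cores rev_p rev_v split_A cr1 cr2.
    have cA : c \in A by apply: sub; rewrite -defC.
    have c'A : c' \notin A by apply: sub'; rewrite -defC'.
    case: join => [/negPn/eqP eqc|/negPn cc']; first by rewrite eqc (negbTE c'A) in cA.
    by have := splits_closed split_A cA _ cc'; rewrite in_setU cC' orbT (negbTE c'A) => /(_ isT).
  have [[WU NU SU EU] [Wlim Elim] [Slim Nlim]] :=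
    core_in_corners (in_core setT (subsetT C) (subsetT C')).1 (in_core setT (subsetT C) (subsetT C')).2.
  have inU t : t \in C -> t \in C :|: C' by rewrite in_setU => ->.
  have inU' t : t \in C' -> t \in C :|: C' by rewrite in_setU orbC => ->.
  have SC : S \in C by rewrite defC !inE eqxx !orbT.
  have NC' : N \in C' by rewrite defC' !inE eqxx !orbT.
  have W1 t : p W <= p t := Wlim t (in_setT t).
  have E1 t : p t <= p E := Elim t (in_setT t).
  have S1 t : v S <= v t := Slim t (in_setT t).
  have N1 t : v t <= v N := Nlim t (in_setT t).
  case: (critical_tower sigma_critical UT cr1 cr2 nsplitU) => -[f f_infl].
    by case: (no_tower3412 sigma_critical n_ge9 W1 E1 S1 N1 (inU _ WC) (inU' _ NC')
             (inU _ SC) (inU' _ EC') f_infl).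
  by case: (no_tower4231 sigma_critical n_ge9 W1 E1 S1 N1 (inU _ WC) (inU' _ NC')
             (inU _ SC) (inU' _ EC') f_infl).
have disj : [disjoint C & C'].
  apply/pred0Pn => -[t /andP[tC tC']].
  by have := sep t t tC tC'; rewrite eqxx.
have nadj : {in C & C', forall c c', ~~ adj p v c c'}.
  by move=> c c' cC cC'; have /andP[] := sep c c' cC cC'.
have adj_irr : irreflexive (adj p v) by move=> t; rewrite /adj /nw !ltnn.
have [Q geo] := geodesic_exists (@adjC _ p v) adj_irr disj WC EC'
  (connect_splits E p_inj v_inj (fun t => (lim t).1) nsplit).
have full t : [|| t \in C, t \in Q | t \in C'].
  pose U := [set t | [|| t \in C, t \in Q | t \in C']].
  suff /eqP UT : U == setT by have := in_setT t; rewrite -UT in_set.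
  have [sC sC'] : C \subset U /\ C' \subset U.
    by split; apply/subsetP => u uC; rewrite in_set uC ?orbT.
  have [cr1 cr2] := in_core U sC sC'.
  apply: contraT => UT; have [|WE _] := critical_proper_sets_tight sigma_critical UT cr1 cr2; last first.
    by have := nadj W E WC EC'; rewrite WE.
  move=> A split_A; have [sub sub'] := splits_cores rev_p rev_v split_A cr1 cr2.
  have [_ _ _ _ [c [b [cC bC' qP]]]] := geo.
  have cA : c \in A by apply: sub; rewrite -defC.
  have qU : {subset rcons Q b <= U}.
    move=> u; rewrite mem_rcons in_cons in_set => /orP[/eqP->|->]; last by rewrite orbT.
    by rewrite bC' !orbT.
  have := splits_path split_A cA qU qP; rewrite last_rcons.
  by rewrite (negbTE (sub' b _)) // -defC'.
have Q0 : Q != [::].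
  apply: contraTneq n_ge9 => Qnil; rewrite -leqNgt -[n]card_ord -cardsT.
  have -> : [set: 'I_n] = C :|: C'.
    by apply/setP => t; rewrite in_setT in_setU; have := full t; rewrite Qnil => ->.
  by apply: leq_trans (leq_card_setU _ _) _; rewrite cardC cardC'.
have [cr1 cr2] := in_core setT (subsetT C) (subsetT C').
have [uniqC uniqC' [cyc [cyc' [a [a' [[sz Ucyc memcyc cycE] [sz' Ucyc' memcyc' cycE'] dumb]]]]]] :=
  dumbbell_of_geodesic p_inj v_inj rev_p rev_v cr1 defC cr2 defC' disj nadj geo Q0 full
    (critical_proper_sets_tight sigma_critical).
exists C, C'; split=> //.
- split; first exact: (core_SW_core Wc Sc).
  by move=> D /(SW_core_points Wc Nc Sc Ec)[x1 [y1 [cr3 ->]]]; rewrite uniqC.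
- split; first exact: (core_NE_core Nc Ec).
  by move=> D /(NE_core_points Wc Nc Sc Ec)[x1 [y1 [cr3 ->]]]; rewrite uniqC'.
exists cyc, cyc', a, a', Q.
have [_ [Uall memall] _ _] := dumb.
split.
- by split=> // t u; rewrite cycE cov_adj_min_inversion.
- by split=> // t u; rewrite cycE' cov_adj_min_inversion.
- have [? ? ? edges] := dumb; split=> // t u.
  by rewrite cover_graph_cov_adj edges.
have := card_uniqP Uall; rewrite (eq_card (B := 'I_n)) => [|t]; last by rewrite memall.
by rewrite card_ord !size_cat sz sz'; move: (size Q); clear; lia.
Qed.
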